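(* Let $X$ be a separable Banach space such that $X^{**}$ is non-separable, $\ell_1$ does not isomorphically embed into $X$, and no spreading model generated by a normalized weakly null sequence in $X$ is equivalent to the unit vector basis of $\ell_1$. If $X$ coarsely embeds into a Banach space $Y$, then there exists $k\in\mathbb{N}$ such that the iterated dual $Y^{(2k)}$ of order $2k$ is non-separable.
   Context: A map $f:X\to Y$ is a coarse embedding if there are non-decreasing $\rho,\omega:[0,\infty)\to[0,\infty)$ with $\lim_{t\to\infty}\rho(t)=\infty$ and $\rho(\|x-y\|)\le\|f(x)-f(y)\|\le\omega(\|x-y\|)$. A sequence $(x_n)$ in $X$ generates a spreading model $(e_j)$ if for every $k$ and scalars $a_1,\dots,a_k$, $\lim_{n_1\to\infty}\cdots\lim_{n_k\to\infty}$ with $n_1<\dots<n_k$ of $\|\sum_{j=1}^k a_jx_{n_j}\|$ exists and equals $\|\sum_j a_je_j\|$ (a seminorm/norm on sequences). $Y^{(m)}$ denotes the $m$-th iterated dual of $Y$. *)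

(* Defs.v *)
From HB Require Import structures.
From mathcomp Require Import all_boot all_order all_algebra.
From mathcomp Require Import all_classical all_reals all_analysis.
Set Implicit Arguments. Unset Strict Implicit. Unset Printing Implicit Defensive.
Import Order.TTheory GRing.Theory Num.Theory numFieldNormedType.Exports.
Local Open Scope classical_set_scope.
Local Open Scope ring_scope.

(* A (semi)normed real vector space given by a carrier type, a membership
   predicate singling out the actual vectors, operations and a norm. *)
Record vsn (R : realType) := VSN {
  car : Type;
  vmem : car -> Prop;
  vadd : car -> car -> car;
  vscale : R -> car -> car;
  vzero : car;
  vnorm : car -> R }.
Arguments car {R} v.
Arguments vmem {R} v _.
Arguments vadd {R} v _ _.
Arguments vscale {R} v _ _.
Arguments vzero {R} v.
Arguments vnorm {R} v _.

Definition of_normed (R : realType) (V : normedModType R) : vsn R :=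
  @VSN R V (fun _ => True) (fun x y => x + y) (fun a x => a *: x) 0
       (fun x => `|x|).

Definition dual (R : realType) (V : vsn R) : vsn R :=
  @VSN R (car V -> R)
    (fun f =>
       (forall x y, vmem V x -> vmem V y -> f (vadd V x y) = f x + f y) /\
       (forall a x, vmem V x -> f (vscale V a x) = a * f x) /\
       (exists C : R, forall x, vmem V x -> `|f x| <= C * vnorm V x))
    (fun f g x => f x + g x) (fun a f x => a * f x) (fun _ => 0)
    (fun f => sup [set r | exists x, [/\ vmem V x, vnorm V x <= 1 & r = `|f x|]]).

Fixpoint idual (R : realType) (m : nat) (V : vsn R) : vsn R :=
  match m with
  | 0 => V
  | m'.+1 => dual (idual m' V)
  end.

Definition separable (R : realType) (V : vsn R) : Prop :=
  exists D : nat -> car V, (forall n, vmem V (D n)) /\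
    forall x, vmem V x -> forall e : R, 0 < e ->
      exists n, vnorm V (vadd V x (vscale V (-1) (D n))) < e.

Definition l1_norm_is (R : realType) (a : nat -> R) (s : R) : Prop :=
  series (fun k => `|a k|) @ \oo --> s.

Definition in_l1 (R : realType) (a : nat -> R) : Prop := exists s, l1_norm_is a s.

Definition l1_embeds (R : realType) (X : normedModType R) : Prop :=
  exists T : (nat -> R) -> X,
    (forall a b, in_l1 a -> in_l1 b -> T (a \+ b) = T a + T b) /\
    (forall (r : R) a, in_l1 a -> T (fun k => r * a k) = r *: T a) /\
    exists c C : R, 0 < c /\ 0 < C /\
      forall a s, l1_norm_is a s -> c * s <= `|T a| /\ `|T a| <= C * s.

Definition weakly_null (R : realType) (X : normedModType R) (x : nat -> X) : Prop :=
  forall f : X -> R,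
    (forall (a : R) (u v : X), f (a *: u + v) = a * f u + f v) ->
    continuous f -> (fun n => f (x n)) @ \oo --> 0.

(* itlim x a acc m L :  lim_{n_1 -> oo} ... lim_{n_k -> oo}, m < n_1 < ... < n_k,
   of || acc + sum_j a_j x_{n_j} || exists and equals L. *)
Fixpoint itlim (R : realType) (X : normedModType R) (x : nat -> X)
    (a : seq R) (acc : X) (m : nat) (L : R) : Prop :=
  match a with
  | [::] => L = `|acc|
  | a1 :: a' => exists g : nat -> R,
      (forall n, (m < n)%N -> itlim x a' (acc + a1 *: x n) n (g n)) /\
      g @ \oo --> L
  end.

(* (x_n) generates the spreading model whose norm is sm :
   ||sum_j a_j e_j|| = sm [:: a_1; ...; a_k]. *)
Definition generates_sm (R : realType) (X : normedModType R) (x : nat -> X)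
    (sm : seq R -> R) : Prop :=
  forall a : seq R, itlim x a 0 0%N (sm a).

Definition sm_equiv_l1 (R : realType) (sm : seq R -> R) : Prop :=
  exists c C : R, 0 < c /\ 0 < C /\ forall a : seq R,
    c * \sum_(r <- a) `|r| <= sm a /\ sm a <= C * \sum_(r <- a) `|r|.

Definition nondecr_nonneg (R : realType) (h : R -> R) : Prop :=
  (forall t, 0 <= t -> 0 <= h t) /\ (forall s t, 0 <= s -> s <= t -> h s <= h t).

Definition coarse_embedding (R : realType) (X Y : normedModType R) (f : X -> Y) : Prop :=
  exists rho omega : R -> R,
    nondecr_nonneg rho /\ nondecr_nonneg omega /\ rho @ +oo --> +oo /\
    forall x y : X, rho `|x - y| <= `|f x - f y| /\ `|f x - f y| <= omega `|x - y|.

(* Main.v *)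
(* "Most" means almost all along a fixed nonprincipal ultrafilter, one coordinate after
   the other, and limits are along it.  Suppose that all even duals of [Y] are separable
   and that [f] embeds [X] coarsely into [Y].  Let [x] be a bounded weakly Cauchy
   sequence in [X].  As no spreading model of a normalized weakly null
   sequence is equivalent to the l_1 basis, for each [eta > 0] there are nonnegative
   integers [b_1, ..., b_r], not all zero, with
     |sum_j b_j (x_{n_j} - x_{m_j})| <= eta * sum_j b_j
   for most n_1 < m_1 < n_2 < m_2 < ... < m_r.  So h_x(n) = f (c sum_j b_j x_{n_j}), with
   c = 1 / (eta sum_j b_j), moves by at most omega(1) between interlacing tuples.
   Kalton's argument shows that if the iterated weak-star limits of h_x and h_x' in the
   2r-th dual of [Y] are close, then h_x and h_x' are close at most tuples; by coarseness
   the weak-star limits of [x] and [x'] in X** are then close.  Separability of the even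
   duals thus splits the bounded weakly Cauchy sequences into countably many classes,
   each with limits of small diameter.

   Representatives of the classes have norm dense limits in X**.  Otherwise some G in X**
   is kept away from each of them by a functional phi_i; Helly's lemma gives a bounded
   sequence in [X] whose values at every phi_i tend to G phi_i, and by Rosenthal's l_1
   theorem it has a weakly Cauchy subsequence, which belongs to one of the classes: a
   contradiction. *)
Require Import Defs.
From HB Require Import structures.
From mathcomp Require Import all_boot all_order all_algebra.
From mathcomp Require Import all_classical all_reals all_analysis.
From mathcomp Require Import ring lra zify.
Import Order.TTheory GRing.Theory Num.Theory numFieldNormedType.Exports.
Set Implicit Arguments. Unset Strict Implicit. Unset Printing Implicit Defensive.
Local Open Scope classical_set_scope.
Local Open Scope ring_scope.

(** * Limits along ultrafilters *)

Lemma ultrafilterC (Z : Type) (V : set_system Z) {PV : ProperFilter V} :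
  (forall A, V A \/ V (~` A)) -> UltraFilter V.
Proof.
move=> VC; split=> // G PG VG; rewrite predeqE => A; split; last exact: VG.
move=> GA; have [//|/VG GnA] := VC A.
by have /filter_ex [x []] : G (A `&` ~` A) by exact: filterI.
Qed.

(** [lim] is total. For bounded [u], compactness of segments makes [u] converge along any
    ultrafilter, so the value is then a genuine limit and no convergence has to be assumed. *)
Definition ulim (R : realType) (Z : Type) (V : set_system Z) (u : Z -> R) : R :=
  lim (u @ V).

Lemma ulim_cvg (R : realType) (Z : Type) (V : set_system Z) {UV : UltraFilter V}
    (u : Z -> R) (K : R) :
  (forall z, `|u z| <= K) -> u @ V --> ulim V u.
Proof.
move=> uK.
have cpt : compact (`[- K, K]%classic : set R) by exact: segment_compact.
have UuV : UltraFilter (u @ V).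
  by apply: ultrafilterC => A; exact: in_ultra_setVsetC (u @^-1` A) UV.
move: cpt; rewrite compact_ultra => /(_ (u @ V) UuV) [].
  by apply: nearW => z; rewrite /= in_itv /= -ler_norml.
move=> l [_ ul]; rewrite /ulim (_ : lim _ = l) //; exact: cvg_lim.
Qed.

Lemma ulim_eq (R : realType) (Z : Type) (V : set_system Z) {PV : ProperFilter V}
    (u : Z -> R) (l : R) : u @ V --> l -> ulim V u = l.
Proof. by move=> ul; exact: cvg_lim. Qed.

Lemma ulim_cst (R : realType) (Z : Type) (V : set_system Z) {PV : ProperFilter V}
    (c : R) : ulim V (fun _ => c) = c.
Proof. by apply: ulim_eq; exact: cvg_cst. Qed.

Section Ulim.
Context (R : realType) (Z : Type) (V : set_system Z) {UV : UltraFilter V}.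
Implicit Types (u v : Z -> R) (K L c a : R).

Lemma ulimD u v K L : (forall z, `|u z| <= K) -> (forall z, `|v z| <= L) ->
  ulim V (fun z => u z + v z) = ulim V u + ulim V v.
Proof.
by move=> uK vL; apply: ulim_eq; apply: cvgD; [exact: ulim_cvg uK|exact: ulim_cvg vL].
Qed.

Lemma ulimZ a u K : (forall z, `|u z| <= K) ->
  ulim V (fun z => a * u z) = a * ulim V u.
Proof.
by move=> uK; apply: ulim_eq; apply: cvgM; [exact: cvg_cst|exact: ulim_cvg uK].
Qed.

Lemma ulim_ge u K c : (forall z, `|u z| <= K) -> V [set z | c <= u z] -> c <= ulim V u.
Proof. by move=> uK cu; apply: limr_ge => //; apply: cvgP (ulim_cvg uK). Qed.

Lemma ulim_le u K c : (forall z, `|u z| <= K) -> V [set z | u z <= c] -> ulim V u <= c.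
Proof. by move=> uK cu; apply: limr_le => //; apply: cvgP (ulim_cvg uK). Qed.

Lemma ler_ulim u v K L : (forall z, `|u z| <= K) -> (forall z, `|v z| <= L) ->
  (forall z, u z <= v z) -> ulim V u <= ulim V v.
Proof.
move=> uK vL uv; have uK' z : `|-1 * u z| <= K by rewrite mulN1r normrN.
rewrite -subr_ge0 -mulN1r -(ulimZ _ uK) -(ulimD vL uK').
apply: (@ulim_ge _ (L + K)) => [z|].
  by apply: le_trans (ler_normD _ _) _; exact: lerD.
by apply: nearW => z /=; rewrite mulN1r subr_ge0.
Qed.

Lemma ulim_norm_le u K : (forall z, `|u z| <= K) -> `|ulim V u| <= K.
Proof.
move=> uK; rewrite ler_norml; apply/andP; split.
  by apply: (ulim_ge uK); apply: nearW => z /=; have := uK z; rewrite ler_norml => /andP[].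
by apply: (ulim_le uK); apply: nearW => z /=; have := uK z; rewrite ler_norml => /andP[].
Qed.

Lemma ulim_near u K e : (forall z, `|u z| <= K) -> 0 < e ->
  V [set z | `|ulim V u - u z| < e].
Proof. by move=> uK e0; exact: (proj1 (cvgrPdist_lt _ _) (ulim_cvg uK) e e0). Qed.

End Ulim.

(** This is membership in the [r]-th Fubini power of [V], regarded as a family of sets of tuples,
    with the first coordinate as outermost quantifier. *)
Fixpoint iter_near (Z : Type) (V : set_system Z) (r : nat) (P : seq Z -> Prop) : Prop :=
  match r with
  | 0 => P [::]
  | r'.+1 => V [set z | iter_near V r' (fun s => P (z :: s))]
  end.

Section IterNear.
Context (Z : Type) (V : set_system Z).
Implicit Types (P Q : seq Z -> Prop).

(** The definition peels off the first coordinate, whereas the iterated weak-star limits are taken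
    in the last one; this converts between the two. *)
Lemma iter_nearS_rcons r P :
  iter_near V r.+1 P <-> iter_near V r (fun s => V [set z | P (rcons s z)]).
Proof.
elim: r P => [//|r IH] P.
have E : [set z | iter_near V r.+1 (fun s => P (z :: s))] =
    [set z | iter_near V r (fun s => V [set z' | P (z :: rcons s z')])].
  by apply/funext => z; apply/propext; exact: IH.
change (V [set z | iter_near V r.+1 (fun s => P (z :: s))] <->
  iter_near V r.+1 (fun s => V [set z | P (rcons s z)])).
by rewrite E.
Qed.

Context {PV : ProperFilter V}.

Lemma iter_near_mono r P Q :
  (forall s, size s = r -> P s -> Q s) -> iter_near V r P -> iter_near V r Q.
Proof.
elim: r P Q => [|r IH] P Q PQ /=; first exact: PQ.
by apply: filterS => z; apply: IH => s sr; apply: PQ => /=; rewrite sr.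
Qed.

Lemma iter_near_and r P Q :
  iter_near V r P -> iter_near V r Q -> iter_near V r (fun s => P s /\ Q s).
Proof.
elim: r P Q => [|r IH] P Q //=; apply: filterS2 => z; exact: IH.
Qed.

Lemma iter_near_ex r P : iter_near V r P -> exists2 s, size s = r & P s.
Proof.
elim: r P => [|r IH] P /=; first by exists [::].
by move=> /filter_ex[z /IH[s sr Ps]]; exists (z :: s); rewrite //= sr.
Qed.

Lemma iter_near_each r (A : set Z) : V A ->
  iter_near V r (fun s => forall i z0, (i < r)%N -> A (nth z0 s i)).
Proof.
move=> VA; elim: r => [//|r IH] /=.
apply: filterS VA => z Az; apply: iter_near_mono IH => s _ H [|i] z0 //= ir.
exact: H.
Qed.

End IterNear.

Lemma iter_near_ultra (Z : Type) (V : set_system Z) {UV : UltraFilter V} r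
    (P : seq Z -> Prop) : ~ iter_near V r P -> iter_near V r (fun s => ~ P s).
Proof.
elim: r P => [//|r IH] P /= nP.
have [//|] := in_ultra_setVsetC [set z | iter_near V r (fun s => P (z :: s))] UV.
by apply: filterS => z /= /IH.
Qed.

(* Diagonalization: [p l] is chosen in the intersection of the finitely many sets
   [g k t] with [k <= l] and [t] a subsequence of [p 0, ..., p (l - 1)]. *)
Lemma strategy (Z : Type) (V : set_system Z) {PV : ProperFilter V}
    (g : nat -> seq Z -> set Z) :
  (forall k t, V (g k t)) ->
  exists p : nat -> Z, forall k l s, (k <= l)%N -> sorted ltn s ->
    all (fun i => (i < l)%N) s -> g k (map p s) (p l).
Proof.
move=> Vg.
have next (s : seq Z) : exists z, forall (k : 'I_(size s).+1) (b : (size s).-tuple bool),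
    g k (mask b s) z.
  apply: (@filter_ex _ V); apply: filter_forall => k.
  by apply: (@filter_forall _ _ (fun b : (size s).-tuple bool => g k (mask b s))) => b; exact: Vg.
have [c cP] := choice next.
pose L := fix L n := if n is n'.+1 then rcons (L n') (c (L n')) else [::].
pose p n := c (L n).
have pL n : mkseq p n = L n by elim: n => //= n IH; rewrite mkseqS IH.
have sL n : size (L n) = n by rewrite -pL size_mkseq.
exists p => k l s kl ss sl.
(* An increasing [s] below [l] is the mask of [iota 0 l] by membership in [s], so [map p s] is one
   of the subsequences that [next] takes care of. *)
have -> : s = seq.filter (mem s) (iota 0 l).
  apply: (irr_sorted_eq ltn_trans ltnn) => //.
    by apply: sorted_filter; [exact: ltn_trans|exact: iota_ltn_sorted].
  move=> i; rewrite mem_filter /= mem_iota add0n /=.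
  by case: (boolP (i \in s)) => // /(allP sl) ->.
rewrite filter_mask map_mask -/(mkseq p l) pL.
have sb : size (map (mem s) (iota 0 l)) == size (L l) by rewrite size_map size_iota sL.
have kl' : (k < (size (L l)).+1)%N by rewrite sL.
exact: (cP (L l) (Ordinal kl') (Tuple sb)).
Qed.

Lemma exists_invS_lt (R : realType) (e : R) : 0 < e -> exists N : nat, N.+1%:R^-1 < e.
Proof.
move=> e0; have ei : 0 <= e^-1 by rewrite invr_ge0 ltW.
exists (Num.bound e^-1); rewrite invf_plt ?posrE ?ltr0n //.
by apply: lt_trans (archi_boundP ei) _; rewrite ltr_nat.
Qed.

(** * Norming functionals *)

Definition sublinear (R : realType) (E : lmodType R) (p : E -> R) : Prop :=
  (forall x y, p (x + y) <= p x + p y) /\ (forall (a : R) x, 0 <= a -> p (a *: x) = a * p x).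

Definition functional (R : realType) (E : normedModType R) (phi : E -> R) : Prop :=
  [/\ forall x y, phi (x + y) = phi x + phi y, forall (a : R) x, phi (a *: x) = a * phi x
    & forall x, `|phi x| <= `|x|].

Lemma sublinear0 (R : realType) (E : lmodType R) (p : E -> R) : sublinear p -> p 0 = 0.
Proof. by move=> [_ /(_ 0 0 (lexx _))]; rewrite scale0r mul0r. Qed.

Lemma sublinear_opp (R : realType) (E : lmodType R) (p : E -> R) x :
  sublinear p -> - p (- x) <= p x.
Proof.
move=> sp; have := sp.1 x (- x); rewrite subrr (sublinear0 sp) => h; lra.
Qed.

(* The largest sublinear functional below [p] whose value at [- x] is at most [- p x]. *)
Definition descend (R : realType) (E : lmodType R) (p : E -> R) (x v : E) : R :=
  inf [set r | exists2 t : R, 0 <= t & r = p (v + t *: x) - t * p x].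

Section Descend.
Context (R : realType) (E : lmodType R) (p : E -> R) (x : E) (sp : sublinear p).

Let D v := [set r | exists2 t : R, 0 <= t & r = p (v + t *: x) - t * p x].

Let D_lb v : lbound (D v) (- p (- v)).
Proof.
move=> _ [t t0 ->]; have := sp.1 (v + t *: x) (- v).
by rewrite (addrC v) addrK sp.2 // => h; lra.
Qed.

Let D_has v : has_inf (D v).
Proof.
split; last by exists (- p (- v)); exact: D_lb.
by exists (p (v + 0 *: x) - 0 * p x), 0.
Qed.

Lemma descend_le v (t : R) : 0 <= t -> descend p x v <= p (v + t *: x) - t * p x.
Proof. by move=> t0; apply: ge_inf; [exact: (D_has v).2|exists t]. Qed.

Lemma descend_lt v (c : R) : descend p x v < c ->
  exists2 t : R, 0 <= t & p (v + t *: x) - t * p x < c.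
Proof.
move=> h; have [_ [t t0 ->] tc] := inf_lt (D_has v).1 h.
by exists t.
Qed.

Lemma descend_le_self v : descend p x v <= p v.
Proof. by have := @descend_le v 0 (lexx _); rewrite scale0r addr0 mul0r subr0. Qed.

Lemma descend_opp : descend p x (- x) <= - p x.
Proof.
have := @descend_le (- x) 1 ler01.
by rewrite scale1r addNr (sublinear0 sp) mul1r sub0r.
Qed.

Lemma sublinear_descend : sublinear (descend p x).
Proof.
have add v w : descend p x (v + w) <= descend p x v + descend p x w.
  apply/ler_addgt0Pr => e e0.
  have [|s s0 hs] := @descend_lt v (descend p x v + e / 2); first lra.
  have [|t t0 ht] := @descend_lt w (descend p x w + e / 2); first lra.
  have := @descend_le (v + w) (s + t) (addr_ge0 s0 t0).
  rewrite scalerDl addrACA; have := sp.1 (v + s *: x) (w + t *: x) => h1 h2.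
  by rewrite mulrDl in h2; lra.
have scale_le (a : R) v : 0 < a -> descend p x (a *: v) <= a * descend p x v.
  move=> a0; rewrite -ler_pdivrMl //; apply/ler_addgt0Pr => e e0.
  have [|t t0 ht] := @descend_lt v (descend p x v + e); first lra.
  have := @descend_le (a *: v) (a * t) (mulr_ge0 (ltW a0) t0).
  rewrite -scalerA -scalerDr (sp.2 _ _ (ltW a0)) -mulrA -mulrBr.
  by rewrite -ler_pdivrMl // => h; apply: le_trans h _; exact: ltW.
split=> // a v; rewrite le_eqVlt => /predU1P[<-|a0].
  rewrite scale0r mul0r; apply/le_anti/andP; split.
    by have := @descend_le 0 0 (lexx _); rewrite scale0r addr0 (sublinear0 sp) mul0r subr0.
  apply: lb_le_inf; first exact: (D_has 0).1.
  by move=> r /(@D_lb 0); rewrite oppr0 (sublinear0 sp) oppr0.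
apply/le_anti; rewrite scale_le //=.
have a0' : 0 < a^-1 by rewrite invr_gt0.
have := @scale_le a^-1 (a *: v) a0'.
by rewrite scalerA mulVf ?gt_eqF// scale1r ler_pdivlMl.
Qed.

End Descend.

Section ChainInf.
Context (R : realType) (E : lmodType R) (q : E -> R).
Context (A : set (E -> R)) (sA : forall p, A p -> sublinear p /\ forall v, p v <= q v).
Context (tA : forall p1 p2, A p1 -> A p2 -> (forall v, p1 v <= p2 v) \/ (forall v, p2 v <= p1 v)).
Context (p0 : E -> R) (Ap0 : A p0).

Definition chain_inf (v : E) : R := inf [set p v | p in A].

Let has v : has_inf [set p v | p in A].
Proof.
split; first by exists (p0 v), p0.
exists (- q (- v)) => _ [p Ap <-]; apply: le_trans _ (sublinear_opp v (sA Ap).1).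
by rewrite lerN2; exact: (sA Ap).2.
Qed.

Lemma chain_inf_le p v : A p -> chain_inf v <= p v.
Proof. by move=> Ap; apply: ge_inf; [exact: (has v).2|exists p]. Qed.

Lemma chain_inf_lt v (c : R) : chain_inf v < c -> exists2 p, A p & p v < c.
Proof. by move=> /(inf_lt (has v).1)[_ [p Ap <-] pc]; exists p. Qed.

(** Subadditivity rests on the chain condition: of two members nearly attaining the infimum at [x]
    and at [y], the smaller one nearly attains both. *)
Lemma sublinear_chain_inf : sublinear chain_inf.
Proof.
split=> [x y|a x a0].
  apply/ler_addgt0Pr => e e0.
  have [|p1 A1 h1] := @chain_inf_lt x (chain_inf x + e / 2); first lra.
  have [|p2 A2 h2] := @chain_inf_lt y (chain_inf y + e / 2); first lra.
  have [h|h] := tA A1 A2.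
    by have := chain_inf_le (x + y) A1; have := (sA A1).1.1 x y; have := h y; lra.
  by have := chain_inf_le (x + y) A2; have := (sA A2).1.1 x y; have := h x; lra.
have [->|an0] := eqVneq a 0.
  rewrite scale0r mul0r; apply/le_anti/andP; split.
    by have := chain_inf_le 0 Ap0; rewrite (sublinear0 (sA Ap0).1).
  apply: lb_le_inf; first exact: (has 0).1.
  by move=> _ [p Ap <-]; rewrite (sublinear0 (sA Ap).1).
have {an0}a0 : 0 < a by rewrite lt_neqAle eq_sym an0.
apply/le_anti/andP; split.
  rewrite -ler_pdivrMl //; apply: lb_le_inf; first exact: (has x).1.
  move=> _ [p Ap <-]; rewrite ler_pdivrMl // -((sA Ap).1.2 a x (ltW a0)).
  exact: chain_inf_le.
apply: lb_le_inf; first exact: (has (a *: x)).1.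
move=> _ [p Ap <-]; rewrite ((sA Ap).1.2 a x (ltW a0)) ler_pM2l //.
exact: chain_inf_le.
Qed.

End ChainInf.

(* Hahn-Banach: a minimal sublinear functional [p] is linear, because
   [descend p x] is a sublinear functional below [p]. *)
Lemma sublinear_minorant (R : realType) (E : lmodType R) (q : E -> R) :
  sublinear q -> exists2 p : E -> R, sublinear p /\ (forall v, p v <= q v) &
    forall x, p (- x) = - p x.
Proof.
move=> sq.
pose T := {p : E -> R | sublinear p /\ forall v, p v <= q v}.
pose mkT p h : T := exist (fun p : E -> R => sublinear p /\ forall v, p v <= q v) p h.
(* The order is reversed, so that a maximal element in Zorn's lemma is a minimal functional. *)
pose Rel : rel T := fun s t => `[< forall v, sval t v <= sval s v >].
have [||||[p [sp pq]] pmin] := @Zorn T Rel.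
- by move=> t; apply/asboolP.
- by move=> r s t /asboolP rs /asboolP st; apply/asboolP => v; exact: le_trans (st v) (rs v).
- move=> [s hs] [t ht] /asboolP /= st /asboolP /= ts; apply: eq_exist.
  by apply/funext => v; apply/le_anti; rewrite ts st.
- move=> A tA; have [[p0 Ap0]|nA] := pselect (A !=set0); last first.
    by exists (mkT q (conj sq (fun v => lexx _))) => s As; case: nA; exists s.
  pose A' := [set sval p | p in A].
  have sA p : A' p -> sublinear p /\ forall v, p v <= q v.
    by move=> [t At <-]; exact: (svalP t).
  have tA' p1 p2 : A' p1 -> A' p2 ->
      (forall v, p1 v <= p2 v) \/ (forall v, p2 v <= p1 v).
    move=> [t1 At1 <-] [t2 At2 <-].
    by have [/asboolP h|/asboolP h] := tA _ _ At1 At2; [right|left].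
  have Ap0' : A' (sval p0) by exists p0.
  have sI := sublinear_chain_inf sA tA' Ap0'.
  have Iq v : chain_inf A' v <= q v.
    by apply: le_trans (chain_inf_le sA Ap0' v Ap0') _; exact: (sA _ Ap0').2.
  exists (mkT _ (conj sI Iq)) => s As; apply/asboolP => v /=.
  by apply: (chain_inf_le sA Ap0'); exists s.
exists p => // x; apply/le_anti/andP; split; last first.
  by have := sublinear_opp x sp; lra.
have sD := sublinear_descend x sp.
have Dq v : descend p x v <= q v by exact: le_trans (descend_le_self _ sp _) (pq v).
have /pmin/(congr1 sval) /= Dp : Rel (mkT p (conj sp pq)) (mkT _ (conj sD Dq)).
  by apply/asboolP => v /=; exact: descend_le_self.
by have := descend_opp x sp; rewrite Dp.
Qed.

(** Hahn-Banach is applied to [descend] of the norm at [x] instead of the norm itself: a linear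
    functional below it satisfies p(-x) <= -|x|, hence norms [x]. *)
Lemma norming_functional (R : realType) (E : normedModType R) (x : E) :
  exists2 phi : E -> R, functional phi & phi x = `|x|.
Proof.
have sn : sublinear (fun v : E => `|v|).
  split; first exact: ler_normD.
  by move=> a v a0; rewrite normrZ ger0_norm.
have [p [sp ple] pN] := sublinear_minorant (sublinear_descend x sn).
have plen v : p v <= `|v| by exact: le_trans (ple v) (descend_le_self _ sn _).
have pZ (a : R) v : p (a *: v) = a * p v.
  have [a0|a0] := leP 0 a; first exact: sp.2.
  rewrite -(opprK a) scaleNr pN sp.2 ?mulNr //.
  by rewrite oppr_ge0 ltW.
have pD v w : p (v + w) = p v + p w.
  apply/le_anti; rewrite sp.1 /=.
  by have := sp.1 (- v) (- w); rewrite -opprD !pN; lra.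
exists p.
  split=> // v; rewrite ler_norml plen andbT.
  by have := plen (- v); rewrite pN normrN; lra.
apply/le_anti; rewrite plen /=.
by have := ple (- x); have := descend_opp x sn; rewrite pN; lra.
Qed.

(** * Rosenthal's theorem *)

Lemma free_ultrafilter : exists U : set_system nat,
  UltraFilter U /\ forall N, U [set n | (N <= n)%N].
Proof.
have [U [UU sU]] := ultraFilterLemma (eventually_filter).
by exists U; split=> // N; apply: sU; exact: nbhs_infty_ge.
Qed.

(* From a losing position, following suitable [V]-large sets forces the sequence out of
   [T] after finitely many steps; otherwise it can be kept inside [T] forever. *)
Inductive loses (Z : Type) (V : set_system Z) (T : seq Z -> Prop) : seq Z -> Prop :=
| loses_out s : ~ T s -> loses V T s
| loses_step s (A : set Z) : V A -> (forall z, A z -> loses V T (rcons s z)) ->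
    loses V T s.

Lemma mkseqS_cons (Z : Type) (w : nat -> Z) n :
  mkseq w n.+1 = w 0%N :: mkseq (fun i => w i.+1) n.
Proof. by rewrite /mkseq /= -(addn0 1%N) iotaDl -map_comp. Qed.

(** Induction on the losing position: the set of the first move, followed by the strategies of the
    positions it leads to, is a single function of the history. *)
Lemma loses_strategy (Z : Type) (V : set_system Z) {PV : ProperFilter V}
    (T : seq Z -> Prop) s :
  loses V T s -> exists g : seq Z -> set Z, (forall t, V (g t)) /\
    forall w : nat -> Z, (forall i, g (mkseq w i) (w i)) ->
      exists j, ~ T (s ++ mkseq w j).
Proof.
elim=> {s} [s nT|s A VA _ IH].
  by exists (fun _ => setT); split=> [t|w _]; [exact: filterT|exists 0%N; rewrite cats0].
have /choice[G GP] z : exists g : seq Z -> set Z, (forall t, V (g t)) /\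
    (A z -> forall w : nat -> Z, (forall i, g (mkseq w i) (w i)) ->
      exists j, ~ T (rcons s z ++ mkseq w j)).
  have [Az|nAz] := pselect (A z); first by have [g [Vg gP]] := IH z Az; exists g.
  by exists (fun _ => setT); split=> // t; exact: filterT.
exists (fun t => if t is z :: t' then G z t' else A); split.
  by case=> [//|z t]; exact: (GP z).1.
move=> w gw; have [||j nT] := (GP (w 0%N)).2 _ (fun i => w i.+1).
- exact: (gw 0%N).
- move=> i; pose F t := if t is z :: t' then G z t' else A.
  have h : F (mkseq w i.+1) (w i.+1) := gw i.+1.
  by rewrite mkseqS_cons in h.
by exists j.+1; rewrite mkseqS_cons -cat_rcons.
Qed.

Lemma not_loses (Z : Type) (V : set_system Z) {UV : UltraFilter V}
    (T : seq Z -> Prop) s :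
  ~ loses V T s -> T s /\ V [set z | ~ loses V T (rcons s z)].
Proof.
move=> nl; split; first by apply: contrapT => nT; apply: nl; exact: loses_out.
have [h|//] := in_ultra_setVsetC [set z | loses V T (rcons s z)] UV.
by case: nl; apply: loses_step h _ => z.
Qed.

Lemma sorted_ltn_rcons s l :
  sorted ltn (rcons s l) = all (fun i => (i < l)%N) s && sorted ltn s.
Proof. by rewrite !(sorted_pairwise ltn_trans) pairwise_rcons. Qed.

(** From a position that is not losing, most next moves are not losing either. So [strategy] yields
    one sequence all of whose finite subsequences are such positions, and these lie in [T]. *)
Lemma homogeneous_of_not_loses (Z : Type) (V : set_system Z) {UV : UltraFilter V}
    (T : seq Z -> Prop) :
  ~ loses V T [::] -> exists m : nat -> Z, forall s, sorted ltn s -> T (map m s).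
Proof.
(* For a losing [t] the implication makes this set everything, so it is [V]-large for every [t], as
   [strategy] requires. *)
move=> nl; pose g (k : nat) t := [set z | ~ loses V T t -> ~ loses V T (rcons t z)].
have [k t|m mP] := @strategy Z V _ g.
  have [h|h] := pselect (loses V T t).
    by apply: (filterS _ filterT) => z _ /(_ h).
  by apply: (filterS _ (not_loses h).2) => z nz _; exact: nz.
exists m => s ss; apply: (@not_loses _ V _ _ _ _).1.
elim/last_ind: s ss => [//|s l IH]; rewrite sorted_ltn_rcons => /andP[sl ss].
by rewrite map_rcons; exact: (mP 0%N l s (leq0n _) ss sl (IH ss)).
Qed.

Section Functionals.
Context (R : realType) (E : normedModType R) (phi : E -> R) (fp : functional phi).

Lemma functionalD x y : phi (x + y) = phi x + phi y.
Proof. by case: fp. Qed.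

Lemma functionalZ (a : R) x : phi (a *: x) = a * phi x.
Proof. by case: fp. Qed.

Lemma functional_norm x : `|phi x| <= `|x|.
Proof. by case: fp. Qed.

Lemma functional0 : phi 0 = 0.
Proof. by rewrite -(scale0r 0) functionalZ mul0r. Qed.

Lemma functionalN x : phi (- x) = - phi x.
Proof. by rewrite -scaleN1r functionalZ mulN1r. Qed.

Lemma functionalB x y : phi (x - y) = phi x - phi y.
Proof. by rewrite functionalD functionalN. Qed.

Lemma functional_le x : phi x <= `|x|.
Proof. exact: le_trans (ler_norm _) (functional_norm x). Qed.

Lemma functional_ge x : - `|x| <= phi x.
Proof. by have := functional_norm x; rewrite ler_norml => /andP[]. Qed.

Lemma functional_sum n (F : nat -> E) :
  phi (\sum_(0 <= k < n) F k) = \sum_(0 <= k < n) phi (F k).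
Proof.
elim: n => [|n IH]; first by rewrite !big_geq // functional0.
by rewrite !big_nat_recr //= functionalD IH.
Qed.

End Functionals.

Definition alternates (R : realType) (X : normedModType R) (x : nat -> X) (a b : R)
    (s : seq nat) : Prop :=
  exists2 phi : X -> R, functional phi & forall i, (i < size s)%N ->
    if odd i then b < phi (x (nth 0%N s i)) else phi (x (nth 0%N s i)) < a.

Section L1.
Context (R : realType) (X : completeNormedModType R).

(* Any sign pattern at the positions [3 k + 1] extends to an alternating one: put
   [3 k + 1] second in a pair with [3 k], or first in a pair with [3 k + 2]. *)
Lemma independent_of_alternates (x : nat -> X) (a b : R) (e : nat -> bool) n :
  (forall s, sorted ltn s -> alternates x a b s) ->
  exists2 phi : X -> R, functional phi & forall k, (k < n)%N ->
    if e k then b < phi (x (3 * k + 1)%N) else phi (x (3 * k + 1)%N) < a.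
Proof.
move=> alt; pose q k := if e k then (3 * k)%N else (3 * k + 1)%N.
pose f i := (q i./2 + odd i)%N.
have fS : sorted ltn (mkseq f n.*2).
  apply: homo_sorted (iota_ltn_sorted _ _) => i j ij.
  have {}ij : (i < j)%N := ij; change (f i < f j)%N; rewrite /f /q.
  have := odd_double_half i; have := odd_double_half j; rewrite -!mul2n.
  have [h|h] := eqVneq i./2 j./2; rewrite ?h.
    by case: (e j./2); case: (odd i); case: (odd j) => /= *; lia.
  by case: (e i./2); case: (e j./2); case: (odd i); case: (odd j) => /= *; lia.
have [phi fphi alt_phi] := alt _ fS; exists phi => // k kn.
have nthf i : (i < n.*2)%N -> nth 0%N (mkseq f n.*2) i = f i by move=> ?; rewrite nth_mkseq.
have := alt_phi k.*2; have := alt_phi k.*2.+1; rewrite size_mkseq.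
rewrite ltn_double kn ltn_Sdouble kn !nthf ?ltn_double ?ltn_Sdouble //= /f /q /=.
rewrite odd_double /= doubleK uphalf_double addn0 addn1 => /(_ isT) h1 /(_ isT) h2.
by case: (e k) h1 h2; rewrite ?addn1.
Qed.

(** Take one functional for the sign pattern of [c] and one for the opposite pattern. Their
    difference gains at least b - a on each |c k|, while each is bounded by the norm; this accounts
    for the factor 1/2. *)
Lemma l1_lower_bound (z : nat -> X) (a b : R) :
  (forall (e : nat -> bool) n, exists2 phi : X -> R, functional phi &
    forall k, (k < n)%N -> if e k then b < phi (z k) else phi (z k) < a) ->
  forall (c : nat -> R) n,
    (b - a) / 2 * \sum_(0 <= k < n) `|c k| <= `|\sum_(0 <= k < n) c k *: z k|.
Proof.
move=> ind c n.
have [phi fphi phiP] := ind (fun k => 0 <= c k) n.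
have [psi fpsi psiP] := ind (fun k => c k < 0) n.
suff h : (b - a) * \sum_(0 <= k < n) `|c k| <=
    phi (\sum_(0 <= k < n) c k *: z k) - psi (\sum_(0 <= k < n) c k *: z k).
  have := functional_le fphi (\sum_(0 <= k < n) c k *: z k).
  have := functional_ge fpsi (\sum_(0 <= k < n) c k *: z k).
  by move: h; rewrite mulrAC; lra.
rewrite (functional_sum fphi) (functional_sum fpsi) -sumrB mulr_sumr.
apply: ler_sum_nat => k /andP[_ kn].
have := phiP k kn; have := psiP k kn; rewrite (functionalZ fphi) (functionalZ fpsi) -mulrBr mulrC.
case: (ltP (c k) 0) => ck h1 h2.
  by rewrite ltr0_norm // -(opprK (c k)) opprK mulNr -mulrN ler_nM2l //; lra.
by rewrite ger0_norm // ler_wpM2l //; lra.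
Qed.

Lemma l1_embeds_of_lower_bound (z : nat -> X) (q c : R) :
  0 < c -> (forall k, `|z k| <= q) ->
  (forall (a : nat -> R) n,
    c * \sum_(0 <= k < n) `|a k| <= `|\sum_(0 <= k < n) a k *: z k|) ->
  l1_embeds X.
Proof.
move=> c0 zq low.
pose S (a : nat -> R) := series (fun k => a k *: z k).
have q0 : 0 <= q by exact: le_trans (normr_ge0 _) (zq 0%N).
have cvS a : in_l1 a -> cvgn (S a).
  move=> [s sa]; apply: normed_cvg.
  apply: (@series_le_cvg _ _ (fun k => `|a k| * q)).
  - by move=> n; exact: normr_ge0.
  - by move=> n; exact: mulr_ge0.
  - by move=> n; rewrite /= normrZ ler_wpM2l.
  have -> : series (fun k => `|a k| * q) = (fun n => series (fun k => `|a k|) n * q).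
    by apply/funext => n; rewrite /series /= mulr_suml.
  by apply: cvgP; apply: cvgM; [exact: sa|exact: cvg_cst].
exists (fun a => limn (S a)); split; [|split].
- move=> a b /cvS ca /cvS cb; apply: cvg_lim => //.
  have -> : S (a \+ b) = S a \+ S b.
    apply/funext => n; rewrite /S /series /= -big_split /=.
    by apply: eq_bigr => k _; rewrite scalerDl.
  exact: cvgD.
- move=> r a /cvS ca; apply: cvg_lim => //.
  have -> : S (fun k => r * a k) = (fun n => r *: S a n).
    apply/funext => n; rewrite /S /series /= scaler_sumr.
    by apply: eq_bigr => k _; rewrite scalerA.
  exact: cvgZr.
(* [q] may be 0, but the upper constant has to be positive. *)
exists c, (q + 1); split=> //; split; first lra.
move=> a s sa; have ca : cvgn (S a) by apply: cvS; exists s.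
have cn : (fun n => `|S a n|) @ \oo --> `|limn (S a)| by exact: cvg_norm.
split.
  have cs : (fun n => c * series (fun k => `|a k|) n) @ \oo --> c * s.
    by apply: cvgM => //; exact: cvg_cst.
  rewrite -(cvg_lim (@norm_hausdorff _ _) cs) -(cvg_lim (@norm_hausdorff _ _) cn).
  apply: ler_lim; [exact: cvgP cs|exact: cvgP cn|]; apply: nearW => n; exact: low.
have cs : (fun n => (q + 1) * series (fun k => `|a k|) n) @ \oo --> (q + 1) * s.
  by apply: cvgM => //; exact: cvg_cst.
rewrite -(cvg_lim (@norm_hausdorff _ _) cs) -(cvg_lim (@norm_hausdorff _ _) cn).
apply: ler_lim; [exact: cvgP cn|exact: cvgP cs|]; apply: nearW => n /=.
rewrite /S /series /= mulr_sumr; apply: le_trans (ler_norm_sum _ _ _) _.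
apply: ler_sum_nat => k _; rewrite normrZ mulrC ler_wpM2r //.
by have := zq k; lra.
Qed.

(** The bound [k <= l i] is there for the diagonal argument: the [k]-th strategy is in force only
    from index [k] on. *)
Lemma frequently_alternate (u : nat -> R) (a b : R) (k : nat) :
  (forall N, exists2 n, (N <= n)%N & u n < a) ->
  (forall N, exists2 n, (N <= n)%N & b < u n) ->
  exists l : nat -> nat, [/\ forall i, (k <= l i)%N, forall i, (l i < l i.+1)%N &
    forall i, if odd i then b < u (l i) else u (l i) < a].
Proof.
move=> io_a io_b.
have /choice[f fP] N : exists n, (N <= n)%N /\ u n < a.
  by have [n ? ?] := io_a N; exists n.
have /choice[g gP] N : exists n, (N <= n)%N /\ b < u n.
  by have [n ? ?] := io_b N; exists n.
pose l := fix l i := if i is i'.+1 then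
  (if odd i' then f (l i').+1 else g (l i').+1) else f k.
have lS i : (l i < l i.+1)%N.
  by rewrite /=; case: ifP => _; [exact: (fP _).1|exact: (gP _).1].
exists l; split=> // [i|[|i]] /=; last first.
- by case: (odd i) => /=; [exact: (fP _).2|exact: (gP _).2].
- exact: (fP k).2.
elim: i => [|i IH]; first exact: (fP k).1.
exact: leq_trans IH (ltnW (lS i)).
Qed.

Lemma cvg_of_no_alternation (u : nat -> R) (q : R) :
  (forall n, `|u n| <= q) ->
  (forall a b : rat, ratr a < ratr b :> R ->
    (forall N, exists2 n, (N <= n)%N & u n < ratr a) ->
    (forall N, exists2 n, (N <= n)%N & ratr b < u n) -> False) ->
  cvgn u.
Proof.
move=> uq noalt; have [U [UU Uge]] := free_ultrafilter.
apply: (@cvgP _ _ (ulim U u)); apply/cvgrPdist_lt => e e0; apply: contrapT => nev.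
have far N : exists2 n, (N <= n)%N & e <= `|ulim U u - u n|.
  apply: contrapT => h; apply: nev; exists N => // n /= Nn.
  by rewrite ltNge; apply/negP => en; apply: h; exists n.
have close N : exists2 n, (N <= n)%N & `|ulim U u - u n| < e / 3.
  have e3 : 0 < e / 3 by lra.
  have : U ([set n | (N <= n)%N] `&` [set z | `|ulim U u - u z| < e / 3]).
    by apply: filterI; [exact: Uge|exact: ulim_near uq e3].
  by move=> /filter_ex[n [? ?]]; exists n.
have two_rats (c d : R) : c < d -> exists a b : rat,
    [/\ c < ratr a, ratr a < ratr b :> R & ratr b < d].
  move=> /rat_in_itvoo[a]; rewrite in_itv /= => /andP[ca /rat_in_itvoo[b]].
  by rewrite in_itv /= => /andP[ab bd]; exists a, b.
(* The ultrafilter limit is a cluster value. Values at distance [e] from it recur either above it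
   or, failing that, below it, and then [u] crosses a rational interval on that side infinitely
   often. *)
have [up|nup] := pselect (forall N, exists2 n, (N <= n)%N & ulim U u + e <= u n).
  have [|a [b [ca ab bd]]] := two_rats (ulim U u + e / 3) (ulim U u + e); first lra.
  apply: (noalt a b) => // N.
    have [n Nn] := close N; rewrite ltr_norml => /andP[h _]; exists n => //; lra.
  have [n Nn h] := up N; exists n => //; lra.
have [N0 N0P] : exists N0, forall n, (N0 <= n)%N -> u n < ulim U u + e.
  apply: contrapT => h; apply: nup => N; apply: contrapT => h'; apply: h; exists N => n Nn.
  by rewrite ltNge; apply/negP => en; apply: h'; exists n.
have [|a [b [ca ab bd]]] := two_rats (ulim U u - e) (ulim U u - e / 3); first lra.
apply: (noalt a b) => // N; last first.
  have [n Nn] := close N; rewrite ltr_norml => /andP[_ h]; exists n => //; lra.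
have [n] := far (maxn N N0); rewrite geq_max => /andP[Nn N0n].
have := N0P n N0n => h; rewrite ler_normr => /orP[] h'; exists n => //; lra.
Qed.

(** For a < b play the game [loses] on [alternates]. If the empty position is not losing, a
    homogeneous subsequence spans a copy of l_1. Otherwise every rational pair has a strategy, and a
    subsequence obeying all of them from some index on lets no functional oscillate across a
    rational interval. *)
Lemma rosenthal_l1 (x : nat -> X) (q : R) :
  ~ l1_embeds X -> (forall n, `|x n| <= q) ->
  exists m : nat -> nat, (forall l, (l <= m l)%N) /\
    forall phi : X -> R, functional phi -> cvgn (fun l => phi (x (m l))).
Proof.
move=> nl1 xq; have [U [UU Uge]] := free_ultrafilter.
have los (a b : R) : a < b -> loses U (alternates x a b) [::].
  move=> ab; apply: contrapT => /homogeneous_of_not_loses[m mP]; apply: nl1.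
  pose z k := x (m (3 * k + 1)%N).
  apply: (@l1_embeds_of_lower_bound z q ((b - a) / 2)); first lra.
    by move=> k; exact: xq.
  apply: l1_lower_bound => e n.
  apply: (@independent_of_alternates (fun i => x (m i)) a b e n) => s ss.
  have [phi fphi phiP] := mP s ss; exists phi => // i si.
  by have := phiP i; rewrite size_map (nth_map 0%N) //; exact.
have /choice[g gP] (k : nat) : exists g : seq nat -> set nat, (forall t, U (g t)) /\
    forall a b : rat, unpickle k = Some (a, b) -> ratr a < ratr b :> R ->
    forall w : nat -> nat, (forall i, g (mkseq w i) (w i)) ->
      exists j, ~ alternates x (ratr a) (ratr b) (mkseq w j).
  have triv : forall t : seq nat, U (@setT nat) by move=> _; exact: filterT.
  case E : (unpickle k : option (rat * rat)%type) => [[a b]|]; last first.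
    by exists (fun _ => setT).
  have [ab|ba] := boolP (ratr a < ratr b :> R); last first.
    exists (fun _ => setT); split=> // a' b' -[<- <-] ab.
    by rewrite ab in ba.
  have [g [Ug gw]] := loses_strategy (los _ _ ab).
  by exists g; split=> // a' b' -[<- <-] _.
(* The second set forces [l <= m l], so that the indices tend to infinity. *)
have [k t|m mP] := @strategy nat U _ (fun k t => g k t `&` [set n | (k <= n)%N]).
  by apply: filterI => //; exact: (gP k).1.
exists m; split=> [l|phi fphi]; first by have [] := mP l l [::] (leqnn l) isT isT.
apply: (@cvg_of_no_alternation _ q) => [n|a b ab io_a io_b].
  exact: le_trans (functional_norm fphi _) (xq _).
pose k := pickle (a, b).
have [l [kl lS lP]] := frequently_alternate k io_a io_b.
have lmono i j : (i < j)%N -> (l i < l j)%N.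
  by exact: (homo_ltn ltn_trans lS).
have kE : unpickle k = Some (a, b) by rewrite /k pickleK.
have [|j] := (gP k).2 a b kE ab (fun i => m (l i)).
  move=> i; have -> : mkseq (fun i => m (l i)) i = map m (mkseq l i).
    by rewrite /mkseq -map_comp.
  have [] // := mP k (l i) (mkseq l i) (kl i).
    by apply: homo_sorted (iota_ltn_sorted _ _).
  by apply/allP => _ /mapP[j + ->]; rewrite mem_iota add0n => /= /lmono.
case; exists phi => // i; rewrite size_mkseq => ij; rewrite nth_mkseq //.
Qed.

End L1.

(** * Spreading models *)

(** The Fubini square of [U]. Its iterates choose n_1, m_1, n_2, m_2, ... alternately, which gives
    interlacing tuples when [U] is nonprincipal on the integers. *)
Definition ultra_square (Z : Type) (U : set_system Z) : set_system (Z * Z) :=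
  [set A | U [set n | U [set m | A (n, m)]]].

Lemma ultra_square_ultra (Z : Type) (U : set_system Z) {UU : UltraFilter U} :
  UltraFilter (ultra_square U).
Proof.
have FV : Filter (ultra_square U).
  split=> [|A B|A B AB].
  - by apply: nearW => n; apply: nearW.
  - rewrite /ultra_square /= => hA hB; apply: filterS2 hA hB => n; exact: filterS2.
  - rewrite /ultra_square /= => hA; apply: filterS hA => n; apply: filterS => m; exact: AB.
have PV : ProperFilter (ultra_square U).
  apply: Build_ProperFilter_ex => // A; rewrite /ultra_square /=.
  by move=> /filter_ex[n /filter_ex[m Am]]; exists (n, m).
apply: ultrafilterC => A.
have [h|h] := in_ultra_setVsetC [set n | U [set m | A (n, m)]] UU; first by left.
right; apply: filterS h => n /= nA.
by have [//|] := in_ultra_setVsetC [set m | A (n, m)] UU.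
Qed.

Section Spreading.
Context (R : realType) (X : normedModType R) (Z : Type) (V : set_system Z).
Context {UV : UltraFilter V} (u : Z -> X) (u1 : forall z, `|u z| <= 1).
Implicit Types (a b : seq R) (acc : X) (s : seq Z).

Definition l1_size a : R := \sum_(r <- a) `|r|.
Definition l1_dist a b : R := \sum_(r <- zip a b) `|r.1 - r.2|.

Fixpoint comb (w : Z -> X) a s : X :=
  match a, s with
  | c :: a', z :: s' => c *: w z + comb w a' s'
  | _, _ => 0
  end.

(* Mirrors [itlim], with limits along [V]: the norm of [acc + sum_j a_j e_j] in the
   spreading model over [X] of [u]. *)
Fixpoint smod a acc : R :=
  if a is c :: a' then ulim V (fun z => smod a' (acc + c *: u z)) else `|acc|.

Lemma l1_size_cons c a : l1_size (c :: a) = `|c| + l1_size a.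
Proof. by rewrite /l1_size big_cons. Qed.

Lemma l1_dist_cons c a d b : l1_dist (c :: a) (d :: b) = `|c - d| + l1_dist a b.
Proof. by rewrite /l1_dist /= big_cons. Qed.

Lemma l1_size_ge0 a : 0 <= l1_size a.
Proof. exact: sumr_ge0. Qed.

Lemma norm_scale_le c z : `|c *: u z| <= `|c|.
Proof. by rewrite normrZ ler_piMr. Qed.

Lemma smod_norm_le a acc : `|smod a acc| <= `|acc| + l1_size a.
Proof.
elim: a acc => [|c a IH] acc /=; first by rewrite normr_id /l1_size big_nil addr0.
apply: (@ulim_norm_le _ _ V) => z; apply: le_trans (IH _) _.
rewrite l1_size_cons addrA lerD2r; apply: le_trans (ler_normD _ _) _.
by rewrite lerD2l norm_scale_le.
Qed.

Lemma smod_step_norm_le a acc c z : `|smod a (acc + c *: u z)| <= `|acc| + l1_size (c :: a).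
Proof.
apply: le_trans (smod_norm_le _ _) _.
rewrite l1_size_cons addrA lerD2r; apply: le_trans (ler_normD _ _) _.
by rewrite lerD2l norm_scale_le.
Qed.

Lemma smod_ge0 a acc : 0 <= smod a acc.
Proof.
elim: a acc => [|c a IH] acc; first exact: normr_ge0.
apply: (ulim_ge (smod_step_norm_le a acc c)).
by apply: nearW => z; exact: IH.
Qed.

Lemma smod_lipschitz a b acc acc' : size a = size b ->
  smod a acc <= smod b acc' + (`|acc - acc'| + l1_dist a b).
Proof.
elim: a b acc acc' => [|c a IH] [|d b] acc acc' //=.
  move=> _; rewrite /l1_dist /= big_nil addr0 -lerBlDl; exact: lerB_dist.
move=> [sab]; have bd := smod_step_norm_le b acc' d.
set e := `|acc - acc'| + _.
rewrite -(ulim_cst (V := V) e) -(ulimD bd (fun=> lexx `|e|)).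
apply: (ler_ulim (smod_step_norm_le a acc c) (L := `|acc'| + l1_size (d :: b) + `|e|)).
  by move=> z; apply: le_trans (ler_normD _ _) _; rewrite lerD2r.
move=> z; apply: le_trans (IH b _ (acc' + d *: u z) sab) _; rewrite lerD2l /e l1_dist_cons.
rewrite addrA lerD2r opprD addrACA -scalerBl.
apply: le_trans (ler_normD _ _) _; rewrite lerD2l; exact: norm_scale_le.
Qed.

Lemma l1_distC a b : l1_dist a b = l1_dist b a.
Proof.
elim: a b => [|c a IH] [|d b]; rewrite ?l1_dist_cons ?IH 1?distrC //; by rewrite /l1_dist !big_nil.
Qed.

Lemma smod_dist a b acc acc' : size a = size b ->
  `|smod a acc - smod b acc'| <= `|acc - acc'| + l1_dist a b.
Proof.
move=> sab; rewrite ler_norml; apply/andP; split.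
  have := smod_lipschitz acc' acc (esym sab); rewrite l1_distC distrC; lra.
by have := smod_lipschitz acc acc' sab; lra.
Qed.

(* The convex function [smod a] has subgradients: take [V]-limits of norming functionals.
   Along a weakly null [u] this makes the spreading model suppression unconditional. *)
Lemma smod_subgradient a acc : exists2 psi : X -> R, functional psi &
  forall v, smod a acc + psi v <= smod a (acc + v).
Proof.
elim: a acc => [|c a IH] acc /=.
  have [psi fpsi psiE] := norming_functional acc; exists psi => // v.
  by rewrite -psiE -(functionalD fpsi); exact: functional_le.
have /choice[psi psiP] z : exists psi : X -> R, functional psi /\
    forall v, smod a (acc + c *: u z) + psi v <= smod a (acc + c *: u z + v).
  by have [psi ? ?] := IH (acc + c *: u z); exists psi.
have pb v z : `|psi z v| <= `|v| by exact: functional_norm (psiP z).1 v.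
exists (fun v => ulim V (fun z => psi z v)).
  split=> [v w|t v|v].
  - rewrite -(ulimD (pb v) (pb w)); congr ulim; apply/funext => z.
    exact: functionalD (psiP z).1 _ _.
  - rewrite -(ulimZ t (pb v)); congr ulim; apply/funext => z.
    exact: functionalZ (psiP z).1 _ _.
  - exact: ulim_norm_le.
move=> v; have sb := smod_step_norm_le a acc c.
rewrite -(ulimD sb (pb v)).
apply: (ler_ulim (K := `|acc| + l1_size (c :: a) + `|v|) _ (smod_step_norm_le a (acc + v) c)).
  by move=> z; apply: le_trans (ler_normD _ _) _; apply: lerD.
by move=> z; rewrite addrAC; exact: (psiP z).2.
Qed.

Definition weakly_null_along :=
  forall phi : X -> R, functional phi -> ulim V (fun z => phi (u z)) = 0.

(** Take the limit of the subgradient inequality of [smod a] at [acc] in the direction [c *: u z]: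
    the linear term vanishes because [u] is weakly null. *)
Lemma smod_ge_acc a acc c : weakly_null_along ->
  smod a acc <= smod (c :: a) acc.
Proof.
move=> wn /=; have [psi fpsi psiP] := smod_subgradient a acc.
have pb z : `|psi (u z)| <= 1 by exact: le_trans (functional_norm fpsi _) (u1 z).
have -> : smod a acc = ulim V (fun z => smod a acc + c * psi (u z)).
  rewrite (@ulimD _ _ V _ _ _ `|smod a acc| `|c|) //.
    by rewrite ulim_cst (ulimZ c pb) (wn psi fpsi) mulr0 addr0.
  by move=> z; rewrite normrM ler_piMr.
apply: (ler_ulim (K := `|smod a acc| + `|c|) _ (smod_step_norm_le a acc c)).
  move=> z; apply: le_trans (ler_normD _ _) _; rewrite lerD2l normrM.
  by rewrite ler_piMr.
by move=> z; rewrite -(functionalZ fpsi); exact: psiP.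
Qed.

(** The negative coefficients are deleted one at a time by [smod_ge_acc]. *)
Lemma smod_pos_part a acc : weakly_null_along ->
  smod (map (Num.max 0) a) acc <= smod a acc.
Proof.
move=> wn; elim: a acc => [//|c a IH] acc.
have [c0|c0] := leP 0 c.
  apply: (ler_ulim (smod_step_norm_le _ acc (Num.max 0 c)) (smod_step_norm_le a acc c)).
  by move=> z; rewrite max_r.
apply: (@le_trans _ _ (smod (c :: map (Num.max 0) a) acc)).
  rewrite [leLHS]/= (max_l (ltW c0)).
  rewrite (_ : (fun z => _) = (fun _ => smod (map (Num.max 0) a) acc)); last first.
    by apply/funext => z; rewrite scale0r addr0.
  by rewrite ulim_cst; exact: smod_ge_acc.
apply: (ler_ulim (smod_step_norm_le _ acc c) (smod_step_norm_le a acc c)).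
by move=> z; exact: IH.
Qed.

Lemma smodZ (t : R) a acc : smod (map ( *%R t) a) (t *: acc) = `|t| * smod a acc.
Proof.
elim: a acc => [|c a IH] acc /=; first by rewrite normrZ.
rewrite -(ulimZ _ (smod_step_norm_le a acc c)); congr ulim; apply/funext => z.
by rewrite -IH scalerDr scalerA.
Qed.

Lemma smod_ge_of_iter_near a acc (c : R) :
  iter_near V (size a) (fun s => c <= `|acc + comb u a s|) -> c <= smod a acc.
Proof.
elim: a acc => [|d a IH] acc /=; first by rewrite addr0.
move=> h; apply: (ulim_ge (smod_step_norm_le a acc d)); apply: filterS h => z h.
by apply: IH; apply: iter_near_mono h => s _; rewrite addrA.
Qed.

Lemma comb_rcons w a s c z : size a = size s ->
  comb w (rcons a c) (rcons s z) = comb w a s + c *: w z.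
Proof.
elim: a s => [|d a IH] [|y s] //=; first by rewrite addr0 add0r.
by move=> [sas]; rewrite IH // addrA.
Qed.

Lemma comb_dist a b s : size a = size b -> `|comb u a s - comb u b s| <= l1_dist a b.
Proof.
elim: a b s => [|c a IH] [|d b] s //=; first by rewrite subrr normr0 /l1_dist big_nil.
move=> [sab]; rewrite l1_dist_cons; case: s => [|z s]; last first.
  rewrite opprD addrACA -scalerBl; apply: le_trans (ler_normD _ _) _.
  by apply: lerD; [exact: norm_scale_le|exact: IH].
by rewrite subrr normr0 addr_ge0 // sumr_ge0.
Qed.

Lemma rat_approx a (e : R) : 0 < e ->
  exists r : seq rat, size r = size a /\ l1_dist a (map ratr r) < e.
Proof.
elim: a e => [|c a IH] e e0; first by exists [::]; rewrite /l1_dist big_nil.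
have [r [sr hr]] : exists r : seq rat, size r = size a /\ l1_dist a (map ratr r) < e / 2.
  by apply: IH; lra.
have /rat_in_itvoo[d] : c - e / 2 < c by lra.
rewrite in_itv /= => /andP[d1 d2]; exists (d :: r); split; first by rewrite /= sr.
by rewrite /= l1_dist_cons ger0_norm; lra.
Qed.

(** For rational coefficients, being close to each successive limit is a countable family of
    [V]-large conditions, which [strategy] meets simultaneously; the Lipschitz bound [smod_dist]
    carries the limits over to real coefficients. [G] admits further conditions on the points
    chosen. *)
Lemma spreading_subsequence (G : nat -> set Z) : (forall k, V (G k)) ->
  exists p : nat -> Z, (forall k, G k (p k)) /\
    generates_sm (fun n => u (p n)) (fun a => smod a 0).
Proof.
move=> VG.
pose C := (seq rat * rat * seq rat * nat)%type.
pose toR : seq rat -> seq R := map ratr.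
pose g (k : nat) (t : seq Z) : set Z :=
  if (unpickle k : option C) is Some (b, c, a, N) then
    [set z | `|smod (ratr c :: toR a) (comb u (toR b) t) -
      smod (toR a) (comb u (toR b) t + ratr c *: u z)| < N.+1%:R^-1]
  else setT.
have Vg k t : V (g k t).
  rewrite /g; case: (unpickle k) => [[[[b c] a] N]|]; last exact: filterT.
  apply: (ulim_near (smod_step_norm_le (toR a) (comb u (toR b) t) (ratr c))).
  by rewrite invr_gt0.
have [k t|p pP] := @strategy Z V _ (fun k t => g k t `&` G k).
  by apply: filterI.
exists p; split=> [k|].
  by have [] := pP k k [::] (leqnn k) isT isT.
(* The accumulator of [itlim] is the combination, with coefficients [b], of the points at the
   indices [s] already passed. *)
suff key a b (s : seq nat) m : size b = size s -> sorted ltn s -> all (fun i => (i <= m)%N) s ->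
    itlim (fun n => u (p n)) a (comb u b (map p s)) m (smod a (comb u b (map p s))).
  by move=> a; exact: (key a [::] [::] 0%N).
elim: a b s m => [//|c a IH] b s m sbs ss sm.
exists (fun n => smod a (comb u b (map p s) + c *: u (p n))); split=> [n mn|].
  rewrite -comb_rcons ?size_map // -map_rcons.
  apply: IH; first by rewrite !size_rcons sbs.
    rewrite sorted_ltn_rcons ss andbT; apply: sub_all sm => i im; exact: leq_ltn_trans mn.
  by rewrite all_rcons leqnn; apply: sub_all sm => i im; exact: leq_trans (ltnW mn).
apply/cvgrPdist_lt => e e0.
(* Replacing [a], [b] and [c] by rationals costs less than 3e/8 in the limit and again at index [l];
   the rational condition costs e/4. *)
have e8 : 0 < e / 8 by lra.
have [rb [srb hb]] := rat_approx b e8.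
have [ra [sra ha]] := rat_approx a e8.
have [rc_ [src hc]] := rat_approx [:: c] e8.
case: rc_ src hc => [//|rc [|//]] _; rewrite /= l1_dist_cons /l1_dist big_nil addr0 => hc.
have e4 : 0 < e / 4 by lra.
have [N hN] := exists_invS_lt e4.
pose k := pickle ((rb, rc, ra, N) : C).
exists (maxn k m.+1) => // l /=; rewrite geq_max => /andP[kl ml].
have [] := pP k l s kl ss; first by apply: sub_all sm => i im; exact: leq_ltn_trans ml.
rewrite /g /k pickleK /= => + _.
set t := map p s => h.
have sa' : size a = size (toR ra) by rewrite size_map.
have sb' : size b = size (toR rb) by rewrite size_map.
have hbt := comb_dist t sb'.
have d1 : `|smod (c :: a) (comb u b t) - smod (ratr rc :: toR ra) (comb u (toR rb) t)| <=
    `|comb u b t - comb u (toR rb) t| + l1_dist (c :: a) (ratr rc :: toR ra).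
  by apply: smod_dist; rewrite /= sa'.
have d2 := smod_dist (comb u b t + c *: u (p l)) (comb u (toR rb) t + ratr rc *: u (p l)) sa'.
rewrite l1_dist_cons in d1.
have d3 : `|comb u b t + c *: u (p l) - (comb u (toR rb) t + ratr rc *: u (p l))| <=
    `|comb u b t - comb u (toR rb) t| + `|c - ratr rc|.
  rewrite opprD addrACA -scalerBl; apply: le_trans (ler_normD _ _) _.
  by rewrite lerD2l norm_scale_le.
move: d1 d2 d3 h; rewrite /=.
set A := ulim V _; set A' := ulim V _; set B := smod a _; set B' := smod _ _ => d1 d2 d3 h.
have -> : A - B = (A - A') + ((A' - B') - (B - B')) by ring.
apply: le_lt_trans (ler_normD _ _) _.
have := ler_normB (A' - B') (B - B').
have ha' : l1_dist a (toR ra) < e / 8 := ha.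
have hb' : l1_dist b (toR rb) < e / 8 := hb.
have {}h := lt_trans h hN; move=> hn.
lra.
Qed.

End Spreading.

(** * Lower l_1 estimates and small combinations of differences *)

Lemma l1_size_parts (R : realType) (a : seq R) :
  l1_size a = \sum_(r <- map (Num.max 0) a) r +
              \sum_(r <- map (Num.max 0) (map ( *%R (-1)) a)) r.
Proof.
rewrite /l1_size !big_map -big_split /=; apply: eq_bigr => r _.
case: (ltP r 0) => r0; first by rewrite ltr0_norm // max_r ?mulN1r; lra.
by rewrite ger0_norm // max_l ?mulN1r; lra.
Qed.

Section L1Spreading.
Context (R : realType) (X : normedModType R) (Z : Type) (V : set_system Z).
Context {UV : UltraFilter V} (u : Z -> X) (u1 : forall z, `|u z| <= 1).
Implicit Types (a : seq R) (b : seq nat).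

Definition natseq b : seq R := [seq n%:R | n <- b].

Lemma nat_approx a : all (fun r => 0 <= r) a ->
  exists b, size b = size a /\ l1_dist a (natseq b) <= (size a)%:R.
Proof.
elim: a => [|r a IH]; first by exists [::]; rewrite /l1_dist big_nil.
move=> /andP[r0 /IH[b [sb hb]]]; exists (Num.truncn r :: b); split; first by rewrite /= sb.
rewrite /= l1_dist_cons -natr1.
have /andP[h1 h2] := truncn_itv r0.
by rewrite ger0_norm ?subr_ge0 //; rewrite -natr1 in h2; lra.
Qed.

Lemma sum_natseq b : \sum_(r <- natseq b) r = (sumn b)%:R :> R.
Proof. by rewrite /natseq big_map sumnE natr_sum. Qed.

Lemma sum_le_dist a a' : size a = size a' ->
  \sum_(r <- a) r <= \sum_(r <- a') r + l1_dist a a'.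
Proof.
elim: a a' => [|c a IH] [|d a'] //=; first by rewrite /l1_dist !big_nil addr0.
move=> [sa]; rewrite !big_cons l1_dist_cons; have := IH _ sa; have := ler_norm (c - d); lra.
Qed.

(** Scaling up and rounding down extends the bound from integer to nonnegative coefficients. For
    general [a], the positive parts of [a] and of [-a] are both dominated by [a] itself; adding the
    two bounds loses the factor 2. *)
Lemma smod_l1_lower (k : R) : 0 < k ->
  weakly_null_along V u ->
  (forall b, (0 < sumn b)%N -> k * (sumn b)%:R <= smod V u (natseq b) 0) ->
  forall a, k / 2 * l1_size a <= smod V u a 0.
Proof.
move=> k0 wn hb a.
have pos c : all (fun r => 0 <= r) c -> k * \sum_(r <- c) r <= smod V u c 0.
  move=> c0; rewrite leNgt; apply/negP; rewrite -subr_gt0; set D := _ - _ => D0.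
  (* [B] bounds the effect of rounding whatever the scaling factor, whereas a deficit [D] scales
     with it; [N] is taken so large that [N * D] exceeds [B]. *)
  set B := (1 + k) * (size c)%:R.
  have B0 : 0 <= B by rewrite mulr_ge0 //; lra.
  pose N := Num.bound (B / D).
  have BN : B < N%:R * D by rewrite -ltr_pdivrMr // /N archi_boundP // divr_ge0 // ltW.
  have [|b [sb hbd]] := @nat_approx (map ( *%R N%:R) c).
    by rewrite all_map; apply: sub_all c0 => r /= r0; rewrite mulr_ge0.
  have hb' : k * (sumn b)%:R <= smod V u (natseq b) 0.
    case: (posnP (sumn b)) => [->|]; last exact: hb.
    by rewrite mulr0; exact: smod_ge0.
  have sb' : size (natseq b) = size (map ( *%R N%:R) c) by rewrite [LHS]size_map.
  have h1 := smod_lipschitz (UV := UV) u1 0 0 sb'.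
  have h2 := sum_le_dist (esym sb').
  have h3 := smodZ (UV := UV) u1 N%:R c 0.
  rewrite scaler0 normr_nat in h3.
  have h4 : \sum_(r <- map ( *%R N%:R) c) r = N%:R * \sum_(r <- c) r.
    by rewrite big_map mulr_sumr.
  rewrite size_map in hbd.
  rewrite h3 subrr normr0 add0r l1_distC in h1.
  rewrite h4 sum_natseq in h2.
  have h5 : k * (N%:R * \sum_(r <- c) r) <= k * ((sumn b)%:R + (size c)%:R).
    by rewrite ler_pM2l //; apply: le_trans h2 _; rewrite lerD2l.
  have h6 : N%:R * D = k * (N%:R * \sum_(r <- c) r) - N%:R * smod V u c 0.
    by rewrite /D; ring.
  move: BN; rewrite h6 /B mulrDl mul1r; rewrite mulrDr in h5; lra.
have max0 c : all (fun r : R => 0 <= r) (map (Num.max 0) c).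
  by rewrite all_map; apply/allP => r _ /=; rewrite le_max lexx.
have h1 := le_trans (pos _ (max0 a)) (smod_pos_part (UV := UV) u1 a 0 wn).
have h2 := le_trans (pos _ (max0 (map ( *%R (-1)) a))) (smod_pos_part (UV := UV) u1 _ 0 wn).
have h3 := smodZ (UV := UV) u1 (-1) a 0.
rewrite scaler0 normrN1 mul1r in h3; rewrite h3 in h2.
by rewrite l1_size_parts mulrDr; lra.
Qed.

Lemma comb_close (w w' : Z -> X) (t e : R) a s : size s = size a ->
  (forall i z0, (i < size s)%N -> `|t *: w (nth z0 s i) - w' (nth z0 s i)| <= e) ->
  `|t *: comb w a s - comb w' a s| <= e * l1_size a.
Proof.
elim: a s => [|c a IH] [|z s] //= sas H.
  by rewrite scaler0 subrr normr0 /l1_size big_nil mulr0.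
have {}sas : size s = size a by case: sas.
rewrite l1_size_cons.
have h0 := H 0%N z isT; have h1 := IH s sas (fun i z0 => H i.+1 z0).
rewrite /= in h0; rewrite scalerDr scalerA (mulrC t) -scalerA opprD addrACA -scalerBr.
apply: le_trans (ler_normD _ _) _; rewrite mulrDr; apply: lerD => //.
by rewrite normrZ mulrC ler_wpM2r.
Qed.

End L1Spreading.

Lemma cvg_cauchy (R : realType) (v : nat -> R) : cvgn v ->
  forall e : R, 0 < e -> exists N, forall i j, (N <= i)%N -> (N <= j)%N -> `|v i - v j| < e.
Proof.
move=> cv e e0; have e2 : 0 < e / 2 by lra.
have /cvgrPdist_lt/(_ _ e2)[N _ NP] := cv; exists N => i j Ni Nj.
have h1 := NP i Ni; have h2 := NP j Nj; rewrite /= in h1 h2.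
have -> : v i - v j = (limn v - v j) - (limn v - v i) by ring.
by have := ler_normB (limn v - v j) (limn v - v i); lra.
Qed.

Lemma continuous_linear_norm_le (R : realType) (X : normedModType R) (f : X -> R) :
  (forall (a : R) (v w : X), f (a *: v + w) = a * f v + f w) -> continuous f ->
  exists C : R, 0 < C /\ forall v, `|f v| <= C * `|v|.
Proof.
move=> lf cf.
have f0 : f 0 = 0 by have := lf (-1) 0 0; rewrite scaler0 addr0; lra.
have fZ (a : R) v : f (a *: v) = a * f v by have := lf a v 0; rewrite !addr0 f0 addr0.
have /cvgrPdist_lt/(_ 1 ltr01) := cf 0; rewrite f0.
move=> /nbhs_normP[d /= d0 dP]; exists (2 / d); split; first by rewrite divr_gt0.
move=> v; have [->|v0] := eqVneq v 0; first by rewrite f0 !normr0 mulr0.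
have nv : 0 < `|v| by rewrite normr_gt0.
have dv0 : 0 < d / 2 / `|v| by rewrite !divr_gt0.
have d2 : d / 2 < d by lra.
have := dP ((d / 2 / `|v|) *: v); rewrite /ball_ /= !sub0r !normrN normrZ fZ (normrM _ (f v)).
rewrite (gtr0_norm dv0) divfK ?gt_eqF // => /(_ d2) h.
have -> : 2 / d * `|v| = (d / 2 / `|v|)^-1 by rewrite !invf_div mulrC.
by rewrite -[leRHS]mulr1 ler_pdivlMl // ltW.
Qed.

(** Otherwise every such combination is large. The normalized differences are weakly null, since [x]
    is weakly Cauchy, and the norms of the differences tend to some [lam >= eta], so that
    normalizing nearly amounts to dividing by [lam]. A subsequence then generates an l_1 spreading
    model. *)
Lemma small_differences (R : realType) (X : normedModType R) (U : set_system nat)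
    {UU : UltraFilter U} (x : nat -> X) (q eta : R) :
  (forall N, U [set n | (N <= n)%N]) ->
  (forall (y : nat -> X) (sm : seq R -> R), (forall n, `|y n| = 1) ->
    weakly_null y -> generates_sm y sm -> ~ sm_equiv_l1 sm) ->
  0 < eta -> (forall n, `|x n| <= q) ->
  (forall phi : X -> R, functional phi -> cvgn (fun n => phi (x n))) ->
  exists b : seq nat, (0 < sumn b)%N /\
    iter_near (ultra_square U) (size b)
      (fun s => `|comb (fun z => x z.1 - x z.2) (natseq R b) s| <= eta * (sumn b)%:R).
Proof.
move=> Uge nosm eta0 xq wc; apply: contrapT => none.
set V := ultra_square U in none; have UV : UltraFilter V by exact: ultra_square_ultra.
pose y (z : nat * nat) := x z.1 - x z.2.
have large b : (0 < sumn b)%N ->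
    iter_near V (size b) (fun s => eta * (sumn b)%:R < `|comb y (natseq R b) s|).
  move=> b0; have /iter_near_ultra : ~ iter_near V (size b)
      (fun s => `|comb y (natseq R b) s| <= eta * (sumn b)%:R).
    by move=> h; apply: none; exists b.
  by apply: iter_near_mono => s _ /negP; rewrite -ltNge.
have yq z : `|y z| <= q + q by apply: le_trans (ler_normB _ _) _; exact: lerD.
have nyq z : `| `|y z| | <= q + q by rewrite normr_id.
have y_large : V [set z | eta < `|y z|].
  have := large [:: 1%N] isT; rewrite /= mulr1; apply: filterS => z /=.
  by rewrite addr0 scale1r.
set lam := ulim V (fun z => `|y z|).
have lam_eta : eta <= lam.
  by apply: (ulim_ge nyq); apply: filterS y_large => z /=; exact: ltW.
pose u z := `|y z|^-1 *: y z.
have u1_of z : y z != 0 -> `|u z| = 1.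
  by move=> y0; rewrite /u normrZ normfV normr_id mulVf // normr_eq0.
have u1 z : `|u z| <= 1.
  have [y0|/u1_of ->//] := eqVneq (y z) 0; by rewrite /u y0 scaler0 normr0.
have phiu (phi : X -> R) z : functional phi -> eta < `|y z| ->
    `|phi (u z)| <= `|phi (y z)| / eta.
  move=> fphi yz; rewrite /u (functionalZ fphi) normrM normfV normr_id mulrC.
  apply: ler_wpM2l => //; rewrite lef_pV2 ?posrE ?ltW //; exact: lt_trans yz.
have cauchy (phi : X -> R) e : functional phi -> 0 < e -> exists N,
    forall z : nat * nat, (N <= z.1)%N -> (N <= z.2)%N -> `|phi (y z)| < e.
  move=> fphi e0; have [N NP] := cvg_cauchy (wc phi fphi) e0.
  by exists N => z h1 h2; rewrite /y (functionalB fphi); exact: NP.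
have V_ge N : V [set z | (N <= z.1)%N /\ (N <= z.2)%N].
  by apply: filterS (Uge N) => n Nn; apply: filterS (Uge N) => m Nm.
have wn : weakly_null_along V u.
  move=> phi fphi; have pb z : `|phi (u z)| <= 1 by exact: le_trans (functional_norm fphi _) (u1 z).
  apply/eqP; rewrite -normr_le0; apply/ler_addgt0Pr => e e0; rewrite add0r.
  have small : V [set z | `|phi (u z)| <= e].
    have [N NP] := cauchy phi (e * eta) fphi (mulr_gt0 e0 eta0).
    apply: filterS2 y_large (V_ge N) => z /= yz [z1 z2].
    apply: le_trans (phiu _ _ fphi yz) _; rewrite ler_pdivrMr //; exact: ltW (NP z z1 z2).
  rewrite ler_norml; apply/andP; split.
    by apply: (ulim_ge pb); apply: filterS small => z /=; rewrite ler_norml => /andP[].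
  by apply: (ulim_le pb); apply: filterS small => z /=; rewrite ler_norml => /andP[].
have lam0 : 0 < lam by exact: lt_le_trans lam_eta.
(* The extra conditions keep the chosen differences nonzero and send both of their indices to
   infinity. *)
have [p [Gp smp]] := spreading_subsequence u1 (fun k => filterI y_large (V_ge k)).
have yp0 n : y (p n) != 0.
  by have [h _] := Gp n; rewrite -normr_gt0; exact: lt_trans h.
apply: (nosm (fun n => u (p n)) (fun a => smod V u a 0)) => //.
- by move=> n; exact: u1_of.
- move=> f lf cf; have [C [C0 fC]] := continuous_linear_norm_le lf cf.
  pose phi v := C^-1 * f v.
  have f0 : f 0 = 0 by have := lf (-1) 0 0; rewrite scaler0 addr0; lra.
  have fphi : functional phi.
    split=> [v w|a v|v]; rewrite /phi.
    - by have := lf 1 v w; rewrite scale1r mul1r => ->; rewrite mulrDr.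
    - by have := lf a v 0; rewrite !addr0 f0 addr0 => ->; rewrite mulrCA.
    - by rewrite normrM normfV (gtr0_norm C0) ler_pdivrMl.
  apply/cvgrPdist_lt => e e0.
  have e1 : 0 < e / C * eta by rewrite mulr_gt0 // divr_gt0.
  have [N NP] := cauchy phi _ fphi e1; exists N => // n /= Nn.
  have [yn [n1 n2]] := Gp n.
  have h := phiu phi _ fphi yn.
  have h2 := NP (p n) (leq_trans Nn n1) (leq_trans Nn n2).
  have h3 : `|phi (u (p n))| < e / C by apply: le_lt_trans h _; rewrite ltr_pdivrMr.
  move: h3; rewrite /phi normrM normfV (gtr0_norm C0) mulrC ltr_pM2r ?invr_gt0 //.
  by rewrite sub0r normrN.
(* Replacing [lam *: u] by [y] uses up half of the bound [eta], and dividing by [lam] leaves eta /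
   (2 lam) for integer coefficients; [smod_l1_lower] halves it once more. *)
have k0 : 0 < eta / (2 * lam) by rewrite divr_gt0 // mulr_gt0.
exists (eta / (2 * lam) / 2), 1; split; first by rewrite divr_gt0.
split=> // a; split; last first.
  have := smod_norm_le (UV := UV) u1 a 0; rewrite normr0 add0r mul1r.
  by apply: le_trans; exact: ler_norm.
apply: (smod_l1_lower u1 k0 wn) => b b0.
apply: smod_ge_of_iter_near => //; rewrite size_map.
have e2 : 0 < eta / 2 by lra.
have close : V [set z | `|lam *: u z - y z| <= eta / 2].
  apply: filterS (ulim_near nyq e2) => z /=; rewrite -/lam => h.
  have [y0|y0] := eqVneq (y z) 0.
    by rewrite /u y0 !scaler0 subrr normr0 ltW.
  have yE : `|y z| *: u z = y z by rewrite /u scalerA mulfV ?scale1r // normr_eq0.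
  have -> : lam *: u z - y z = (lam - `|y z|) *: u z by rewrite scalerBl yE.
  by rewrite normrZ (u1_of _ y0) mulr1 ltW.
apply: (iter_near_mono _ (iter_near_and (large b b0) (iter_near_each (size b) close))).
move=> s ss [h1 h2]; rewrite add0r.
have h3 : `|lam *: comb u (natseq R b) s - comb y (natseq R b) s| <= eta / 2 * l1_size (natseq R b).
  by apply: comb_close => [|i z0]; rewrite ss ?size_map // => /h2; apply.
have h4 : l1_size (natseq R b) = (sumn b)%:R.
  rewrite -sum_natseq /l1_size; apply: eq_big_seq => r /mapP[n _ ->].
  by rewrite normr_nat.
have h5 : `|comb y (natseq R b) s| <= `|lam *: comb u (natseq R b) s| +
    `|lam *: comb u (natseq R b) s - comb y (natseq R b) s|.
  by rewrite -[X in `|X| <= _](subKr (lam *: comb u (natseq R b) s)); exact: ler_normB.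
rewrite normrZ (gtr0_norm lam0) in h5; rewrite h4 in h3.
rewrite mulrAC ler_pdivrMr ?mulr_gt0 //.
have := lt_le_trans h1 h5; set A := `|comb u _ _|; set B := (sumn b)%:R; rewrite -/A -/B in h3 *.
move=> h6; have : eta * B <= 2 * (lam * A) by lra.
by rewrite (_ : A * (2 * lam) = 2 * (lam * A)) //; ring.
Qed.

(** * Iterated duals and interlacing *)

(** A fragment of the norm axioms that passes to the dual, hence to all iterated duals, and yields
    the usual bound of [f v] by the dual norm. *)
Definition regular (R : realType) (V : vsn R) : Prop :=
  (forall v, vmem V v -> 0 <= vnorm V v) /\
  (forall (a : R) v, vmem V v -> vmem V (vscale V a v) /\
    vnorm V (vscale V a v) <= `|a| * vnorm V v).

Section Dual.
Context (R : realType) (V : vsn R) (rV : regular V).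
Implicit Types (f : car (dual V)) (v : car V) (c K : R).

Lemma le_dual_norm f v : vmem (dual V) f -> vmem V v -> vnorm V v <= 1 ->
  `|f v| <= vnorm (dual V) f.
Proof.
move=> [_ [_ [C fC]]] Vv v1; apply: ub_le_sup; last by exists v.
exists `|C| => _ [w [Vw w1 ->]]; apply: le_trans (fC w Vw) _.
apply: le_trans (ler_norm _) _; rewrite normrM ler_piMr //.
by rewrite ger0_norm //; exact: rV.1.
Qed.

Lemma dual_norm_le f c : 0 <= c ->
  (forall v, vmem V v -> vnorm V v <= 1 -> `|f v| <= c) -> vnorm (dual V) f <= c.
Proof.
move=> c0 fc; rewrite /=; set S := [set r | _].
(* An abstract unit ball may have no members; [sup] then takes its default value 0, which [0 <= c]
   covers. *)
have [->|/set0P S0] := eqVneq S set0; first by rewrite sup0.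
by apply: ge_sup => // _ [v [Vv v1 ->]]; exact: fc.
Qed.

Lemma dual_eval_le f v K : vmem (dual V) f -> vmem V v -> 0 < K -> vnorm V v <= K ->
  `|f v| <= K * vnorm (dual V) f.
Proof.
move=> fV Vv K0 vK; have [Vs ns] := rV.2 K^-1 v Vv.
have : `|f (vscale V K^-1 v)| <= vnorm (dual V) f.
  apply: le_dual_norm => //; apply: le_trans ns _.
  by rewrite gtr0_norm ?invr_gt0 // ler_pdivrMl // mulr1.
rewrite fV.2.1 // normrM gtr0_norm ?invr_gt0 //.
by rewrite ler_pdivrMl.
Qed.

Lemma dual_add_mem f g : vmem (dual V) f -> vmem (dual V) g ->
  vmem (dual V) (vadd (dual V) f g).
Proof.
move=> [fD [fZ [C fC]]] [gD [gZ [D gD']]]; split; [|split].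
- by move=> x y Vx Vy /=; rewrite fD // gD // addrACA.
- by move=> a x Vx /=; rewrite fZ // gZ // mulrDr.
- exists (C + D) => x Vx /=; rewrite mulrDl; apply: le_trans (ler_normD _ _) _.
  by apply: lerD; [exact: fC|exact: gD'].
Qed.

Lemma dual_scale_mem (a : R) f : vmem (dual V) f -> vmem (dual V) (vscale (dual V) a f).
Proof.
move=> [fD [fZ [C fC]]]; split; [|split].
- by move=> x y Vx Vy /=; rewrite fD // mulrDr.
- by move=> b x Vx /=; rewrite fZ // mulrCA.
- by exists (`|a| * C) => x Vx /=; rewrite normrM -mulrA ler_wpM2l //; exact: fC.
Qed.

Lemma dual_norm_ge0 f : vmem (dual V) f -> 0 <= vnorm (dual V) f.
Proof.
move=> fV; have [[v [Vv v1]]|h] := pselect (exists v, vmem V v /\ vnorm V v <= 1).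
  exact: le_trans (normr_ge0 _) (le_dual_norm fV Vv v1).
rewrite /= (_ : [set r | _] = set0) ?sup0 // -subset0 => r [v [Vv v1 _]].
by case: h; exists v.
Qed.

Lemma regular_dual : regular (dual V).
Proof.
split=> [f fV|a f fV]; first exact: dual_norm_ge0.
split; first exact: dual_scale_mem.
apply: dual_norm_le; first by rewrite mulr_ge0 //; exact: dual_norm_ge0.
by move=> v Vv v1 /=; rewrite normrM ler_wpM2l //; exact: le_dual_norm.
Qed.

End Dual.

Lemma regular_of_normed (R : realType) (E : normedModType R) : regular (of_normed E).
Proof. by split=> [v _|a v _] /=; [exact: normr_ge0|rewrite normrZ]. Qed.

(** Adding two duals at a time makes [bidual j.+1 W] convertible to a double dual, which the types
    of [wlim] and [dwlim] rely on. *)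
Fixpoint bidual (R : realType) (j : nat) (W : vsn R) : vsn R :=
  if j is j'.+1 then dual (dual (bidual j' W)) else W.

Lemma idual_double (R : realType) (k : nat) (W : vsn R) : idual (2 * k) W = bidual k W.
Proof. by elim: k => [|k IH]; rewrite ?muln0 // mulnS /= IH. Qed.

Lemma regular_bidual (R : realType) (j : nat) (W : vsn R) : regular W -> regular (bidual j W).
Proof. by elim: j => //= j IH rW; do 2 apply: regular_dual; exact: IH. Qed.

Lemma iter_near_unzip2 (Z : Type) (U : set_system Z) {UU : UltraFilter U} r (P : seq Z -> Prop) :
  iter_near U r P -> iter_near (ultra_square U) r (fun p => P (unzip2 p)).
Proof.
have UV := @ultra_square_ultra _ U UU.
have PV : ProperFilter (ultra_square U) by exact: ultra_proper.
elim: r P => [//|r IH] P /= hP.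
by apply: nearW => n; apply: filterS hP => m /IH.
Qed.

Section Kalton.
Context (R : realType) (W : vsn R) (rW : regular W) (U : set_system nat).
Context {UU : UltraFilter U}.

(* Iterated weak-star limits of points ([wlim]) and of functionals ([dwlim]); their
   duality pairing is an iterated limit along interlacing sequences. *)
Fixpoint wlim (h : seq nat -> car W) (j : nat) (s : seq nat) : car (bidual j W) :=
  match j return car (bidual j W) with
  | 0 => h s
  | j'.+1 => fun phi => ulim U (fun n => phi (@wlim h j' (rcons s n)))
  end.
Arguments wlim h j s : clear implicits.

Fixpoint dwlim (phi : seq nat -> car (dual W)) (j : nat) (t : seq nat) :
    car (dual (bidual j W)) :=
  match j return car (dual (bidual j W)) with
  | 0 => fun y => ulim U (fun n => phi (rcons t n) y)
  | j'.+1 => fun G => ulim U (fun n => G (@dwlim phi j' (rcons t n)))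
  end.
Arguments dwlim phi j t : clear implicits.

Lemma wlim_mem (h : seq nat -> car W) (K : R) : 0 < K ->
  (forall s, vmem W (h s) /\ vnorm W (h s) <= K) ->
  forall j s, vmem (bidual j W) (wlim h j s) /\ vnorm (bidual j W) (wlim h j s) <= K.
Proof.
move=> K0 hK; elim=> [//|j IH] s; set B := bidual j W in IH *.
have rB : regular B by exact: regular_bidual.
have ev (f : car (dual B)) n : vmem (dual B) f ->
    `|f (wlim h j (rcons s n))| <= K * vnorm (dual B) f.
  by move=> fB; have [? ?] := IH (rcons s n); exact: dual_eval_le.
split; last first.
  apply: dual_norm_le; first exact: ltW.
  move=> f fB f1 /=; apply: ulim_norm_le => n; apply: le_trans (ev f n fB) _.
  by rewrite ger_pMr.
split; [|split].
- move=> f g fB gB /=.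
  exact: (ulimD (fun n => ev f n fB) (fun n => ev g n gB)).
- by move=> a f fB; exact: (ulimZ a (fun n => ev f n fB)).
- by exists K => f fB; apply: ulim_norm_le => n; exact: ev.
Qed.

Lemma dwlim_mem (phi : seq nat -> car (dual W)) :
  (forall t, vmem (dual W) (phi t) /\ forall y, vmem W y -> `|phi t y| <= vnorm W y) ->
  forall j t, vmem (dual (bidual j W)) (dwlim phi j t) /\
    forall v, vmem (bidual j W) v -> `|dwlim phi j t v| <= vnorm (bidual j W) v.
Proof.
move=> phiP; elim=> [|j IH] t.
  have ev n y : vmem W y -> `|phi (rcons t n) y| <= vnorm W y by exact: (phiP _).2.
  split=> [|v Wv]; last by apply: ulim_norm_le => n; exact: ev.
  split; [|split].
  - move=> x y Wx Wy /=; rewrite -(ulimD (fun n => ev n x Wx) (fun n => ev n y Wy)).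
    by congr ulim; apply/funext => n; apply: (phiP _).1.1.
  - move=> a x Wx /=; rewrite -(ulimZ a (fun n => ev n x Wx)).
    by congr ulim; apply/funext => n; apply: (phiP _).1.2.1.
  - by exists 1 => x Wx; rewrite mul1r; apply: ulim_norm_le => n; exact: ev.
set B := bidual j W in IH *.
have rB : regular B by exact: regular_bidual.
have ev (G : car (dual (dual B))) n : vmem (dual (dual B)) G ->
    `|G (dwlim phi j (rcons t n))| <= vnorm (dual (dual B)) G.
  move=> GB; have [mem le] := IH (rcons t n); apply: le_dual_norm => //.
    exact: regular_dual.
  by apply: dual_norm_le => // v Bv v1; apply: le_trans (le v Bv) v1.
split=> [|G GB]; last by apply: ulim_norm_le => n; exact: ev.
split; [|split].
- move=> f g fB gB /=.
  exact: (ulimD (fun n => ev f n fB) (fun n => ev g n gB)).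
- by move=> a f fB; exact: (ulimZ a (fun n => ev f n fB)).
- by exists 1 => f fB; rewrite mul1r; apply: ulim_norm_le => n; exact: ev.
Qed.

(** A lower bound that holds for most tuples of pairs survives the limit in the last pair. Each such
    limit raises the level by one, and after [r] of them no coordinate is left. *)
Lemma iterated_pairing_ge (b1 b2 : nat -> seq nat -> seq nat -> R) (K c : R) (r : nat) :
  (forall j s t, `|b1 j s t| <= K) -> (forall j s t, `|b2 j s t| <= K) ->
  (forall j s t, b1 j.+1 s t = ulim U (fun n => ulim U (fun m => b1 j (rcons s n) (rcons t m)))) ->
  (forall j s t, b2 j.+1 s t = ulim U (fun n => ulim U (fun m => b2 j (rcons s n) (rcons t m)))) ->
  iter_near (ultra_square U) r
    (fun p => c <= b1 0%N (unzip1 p) (unzip2 p) - b2 0%N (unzip1 p) (unzip2 p)) ->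
  c <= b1 r [::] [::] - b2 r [::] [::].
Proof.
move=> K1 K2 E1 E2.
suff step k : forall j, iter_near (ultra_square U) k
      (fun p => c <= b1 j (unzip1 p) (unzip2 p) - b2 j (unzip1 p) (unzip2 p)) ->
    c <= b1 (k + j)%N [::] [::] - b2 (k + j)%N [::] [::].
  by move=> h; have := step r 0%N h; rewrite addn0.
have ulimB (u v : nat -> R) : (forall n, `|u n| <= K) -> (forall n, `|v n| <= K) ->
    ulim U u - ulim U v = ulim U (fun n => u n - v n).
  move=> uK vK; rewrite -mulN1r -(ulimZ _ vK).
  have vK' n : `|-1 * v n| <= K by rewrite mulN1r normrN.
  by rewrite -(ulimD uK vK'); congr ulim; apply/funext => n; rewrite mulN1r.
have bdB (u v : nat -> R) : (forall n, `|u n| <= K) -> (forall n, `|v n| <= K) ->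
    forall n, `|u n - v n| <= K + K.
  by move=> uK vK n; apply: le_trans (ler_normB _ _) _; exact: lerD.
elim: k => [//|k IH] j; rewrite iter_nearS_rcons addSnnS => h; apply: IH.
have PV : ProperFilter (ultra_square U).
  by have UV := @ultra_square_ultra _ U UU; exact: ultra_proper.
apply: iter_near_mono h => p _; rewrite E1 E2 /ultra_square /= => h.
have L1 n : `|ulim U (fun m => b1 j (rcons (unzip1 p) n) (rcons (unzip2 p) m))| <= K.
  exact: ulim_norm_le.
have L2 n : `|ulim U (fun m => b2 j (rcons (unzip1 p) n) (rcons (unzip2 p) m))| <= K.
  exact: ulim_norm_le.
rewrite (ulimB _ _ L1 L2); apply: (ulim_ge (bdB _ _ L1 L2)).
apply: filterS h => n /= h; rewrite ulimB //.
apply: (@ulim_ge _ _ U _ _ (K + K)); first exact: bdB.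
by apply: filterS h => m /=; rewrite /unzip1 /unzip2 !map_rcons.
Qed.

End Kalton.
Arguments wlim {R W} U h j s.
Arguments dwlim {R W} U phi j t.

(* Kalton's interlacing argument: let [phi_m] norm [h1 m - h2 m]. If [n] and [m]
   interlace then [phi_m (h1 n - h2 n)] is within [C1 + C2] of [|h1 m - h2 m|],
   whereas its iterated limit is a value of [wlim h1 - wlim h2] on the unit ball. *)
Lemma kalton (R : realType) (Y : normedModType R) (U : set_system nat)
    {UU : UltraFilter U} (h1 h2 : seq nat -> Y) (K C1 C2 e : R) (r : nat) :
  0 < K -> (forall s, `|h1 s| <= K) -> (forall s, `|h2 s| <= K) ->
  iter_near (ultra_square U) r.+1 (fun p => `|h1 (unzip1 p) - h1 (unzip2 p)| <= C1) ->
  iter_near (ultra_square U) r.+1 (fun p => `|h2 (unzip1 p) - h2 (unzip2 p)| <= C2) ->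
  (forall psi, vmem (dual (bidual r (of_normed Y))) psi ->
    vnorm (dual (bidual r (of_normed Y))) psi <= 1 ->
    wlim (W := of_normed Y) U h1 r.+1 [::] psi -
    wlim (W := of_normed Y) U h2 r.+1 [::] psi < e) ->
  ~ iter_near U r.+1 (fun s => e + C1 + C2 <= `|h1 s - h2 s|).
Proof.
move=> K0 h1K h2K close1 close2 small far.
set W := of_normed Y; have rW : regular W by exact: regular_of_normed.
have UV := @ultra_square_ultra _ U UU.
have PV : ProperFilter (ultra_square U) by exact: ultra_proper.
have /choice[phi phiP] t : exists phi : Y -> R, functional phi /\
    phi (h1 t - h2 t) = `|h1 t - h2 t|.
  by have [phi ? ?] := norming_functional (h1 t - h2 t); exists phi.
have phiW t : vmem (dual W) (phi t) /\ forall y, vmem W y -> `|phi t y| <= vnorm W y.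
  have [fphi _] := phiP t; split=> [|y _]; last exact: functional_norm.
  split=> [x y _ _|]; first exact: functionalD.
  split=> [a x _|]; first exact: functionalZ.
  by exists 1 => x _; rewrite mul1r; exact: functional_norm.
have memP (h : seq nat -> Y) : (forall s, `|h s| <= K) ->
    forall s, vmem W (h s) /\ vnorm W (h s) <= K.
  by move=> hK s; split=> //; exact: hK.
pose psi := dwlim (W := W) U phi.
(* [dwlim] at level [j] has [j + 1] limits taken already, as many as [wlim] at level [j + 1]; the
   plain pairing supplies level 0. *)
pose b (h : seq nat -> Y) j s t :=
  if j is j'.+1 then wlim (W := W) U h j'.+1 s (psi j' t) else phi t (h s).
have ball j t : vnorm (dual (bidual j W)) (psi j t) <= 1.
  have [_ le] := dwlim_mem (U := U) rW phiW j t.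
  by apply: dual_norm_le => // v Wv v1; apply: le_trans (le v Wv) v1.
have bK h : (forall s, `|h s| <= K) -> forall j s t, `|b h j s t| <= K.
  move=> hK [|j] s t; first exact: le_trans (functional_norm (phiP t).1 _) (hK s).
  have [mem le] := wlim_mem (U := U) rW K0 (memP h hK) j.+1 s.
  apply: le_trans (le_dual_norm _ mem _ (ball j t)) le.
    by apply: regular_dual; exact: regular_bidual.
  exact: (dwlim_mem (U := U) rW phiW j t).1.
have bE h j s t : b h j.+1 s t =
    ulim U (fun n => ulim U (fun m => b h j (rcons s n) (rcons t m))) by case: j.
have far' : iter_near (ultra_square U) r.+1
    (fun p => e + C1 + C2 <= `|h1 (unzip2 p) - h2 (unzip2 p)|).
  exact: iter_near_unzip2 far.
have := iterated_pairing_ge (UU := UU) (bK h1 h1K) (bK h2 h2K) (bE h1) (bE h2) (c := e) (r := r.+1).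
have pairing : iter_near (ultra_square U) r.+1
    (fun p => e <= b h1 0%N (unzip1 p) (unzip2 p) - b h2 0%N (unzip1 p) (unzip2 p)).
  apply: (iter_near_mono _ (iter_near_and far' (iter_near_and close1 close2))).
  move=> p _ [hf [hc1 hc2]]; rewrite /b; set s := unzip1 p; set t := unzip2 p.
  have [fphi phiE] := phiP t; rewrite -/s -/t in hf hc1 hc2.
  have k1 := functional_ge fphi (h1 s - h1 t).
  have k2 := functional_le fphi (h2 s - h2 t).
  rewrite -phiE (functionalB fphi) in hf; rewrite !(functionalB fphi) in k1 k2; lra.
move=> /(_ pairing); apply/negP; rewrite -ltNge; apply: small (ball r [::]).
exact: (dwlim_mem (U := U) rW phiW r [::]).1.
Qed.

(** * Coarse embeddings *)

Section Comb.
Context (R : realType) (X : normedModType R) (Z : Type).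
Implicit Types (w : Z -> X) (a : seq R) (s : seq Z).

Lemma comb_norm_le w a s (q : R) : 0 <= q -> (forall z, `|w z| <= q) ->
  `|comb w a s| <= q * l1_size a.
Proof.
move=> q0 wq; elim: a s => [|c a IH] [|z s] /=; rewrite ?normr0 ?mulr_ge0 ?l1_size_ge0 //.
rewrite l1_size_cons mulrDr; apply: le_trans (ler_normD _ _) _; apply: lerD => //.
by rewrite normrZ mulrC ler_wpM2r.
Qed.

Lemma comb_sub w w' a s : comb w a s - comb w' a s = comb (fun z => w z - w' z) a s.
Proof.
elim: a s => [|c a IH] [|z s] /=; rewrite ?subrr //.
by rewrite opprD addrACA -scalerBr IH.
Qed.

Lemma comb_map (T : Type) (g : T -> Z) w a (p : seq T) :
  comb w a (map g p) = comb (fun t => w (g t)) a p.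
Proof. by elim: a p => [|c a IH] [|t p] //=; rewrite IH. Qed.

(** The multipliers are nonnegative, so the lower bounds at the individual points add up without
    cancellation. *)
Lemma functional_comb_ge (phi : X -> R) w (b : seq nat) s (d : R) :
  functional phi -> size s = size b ->
  (forall i z0, (i < size s)%N -> d <= phi (w (nth z0 s i))) ->
  d * (sumn b)%:R <= phi (comb w (natseq R b) s).
Proof.
move=> fphi; elim: b s => [|n b IH] [|z s] //=.
  by rewrite mulr0 (functional0 fphi).
move=> [ss] H; rewrite natrD mulrDr (functionalD fphi) (functionalZ fphi); apply: lerD.
  by rewrite mulrC ler_wpM2l //; exact: (H 0%N z isT).
by apply: IH => // i z0; exact: (H i.+1 z0).
Qed.

End Comb.

Lemma coarse_classes (R : realType) (X Y : normedModType R) (U : set_system nat)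
    {UU : UltraFilter U} (f : X -> Y) (q delta : R) :
  (forall N, U [set n | (N <= n)%N]) ->
  (forall (x : nat -> X) (sm : seq R -> R), (forall n, `|x n| = 1) ->
    weakly_null x -> generates_sm x sm -> ~ sm_equiv_l1 sm) ->
  coarse_embedding f ->
  (forall k, (0 < k)%N -> separable (bidual k (of_normed Y))) ->
  0 < delta ->
  exists Cl : seq nat * nat -> (nat -> X) -> Prop,
  [/\ forall x, (forall n, `|x n| <= q) ->
        (forall phi : X -> R, functional phi -> cvgn (fun n => phi (x n))) ->
        exists i, Cl i x,
      forall i x, Cl i x -> forall n, `|x n| <= q
    & forall i x x' (phi : X -> R), Cl i x -> Cl i x' -> functional phi ->
        `|ulim U (fun n => phi (x n)) - ulim U (fun n => phi (x' n))| <= delta].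
Proof.
move=> Uge nosm [rho [omega [[rho0 rhoM] [[om0 omM] [rhooo fP]]]]] sepY d0.
set W := of_normed Y in sepY; have rW : regular W by exact: regular_of_normed.
(* In [kalton], 2 is the distance allowed between two weak-star limits that lie within 1 of the same
   dense point, and each [omega 1] is the interlacing oscillation of one map. *)
have [R0 R00 rhoR0] : exists2 R0 : R, 0 < R0 & 2 + omega 1 + omega 1 <= rho R0.
  have /cvgryPge/(_ (2 + omega 1 + omega 1)) h := rhooo.
  have [M [_ hM]] := h; exists (Num.max M 0 + 1).
    by rewrite ltr_wpDl // le_max lexx orbT.
  by apply: hM; rewrite ltr_pwDr // le_max lexx.
(* With this [eta], a gap [delta] between the limits separates the scaled combinations by at least
   delta / eta = [R0]. *)
set eta := delta / R0; have eta0 : 0 < eta by rewrite divr_gt0.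
pose D k := sval (cid (sepY k.+1 isT)).
have DP k : (forall n, vmem (bidual k.+1 W) (D k n)) /\
    forall x, vmem (bidual k.+1 W) x -> forall e : R, 0 < e -> exists n,
      vnorm (bidual k.+1 W) (vadd (bidual k.+1 W) x (vscale (bidual k.+1 W) (-1) (D k n))) < e.
  exact: svalP (cid (sepY k.+1 isT)).
pose c (b : seq nat) : R := (eta * (sumn b)%:R)^-1.
pose h b (x : nat -> X) s := f (c b *: comb x (natseq R b) s).
pose V := ultra_square U.
have UV : UltraFilter V by exact: ultra_square_ultra.
pose small b (x : nat -> X) := iter_near V (size b)
  (fun p => `|comb (fun z => x z.1 - x z.2) (natseq R b) p| <= eta * (sumn b)%:R).
(* [0 < sumn b] makes [b] nonempty, so [(size b).-1.+1] is its size, written as a successor for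
   [bidual] to unfold. *)
pose Cl (i : seq nat * nat) (x : nat -> X) := let: (b, n) := i in
  [/\ forall n, `|x n| <= q, (0 < sumn b)%N, small b x &
    let B := bidual (size b).-1.+1 W in
    vnorm B (vadd B (wlim (W := W) U (h b x) (size b).-1.+1 [::])
      (vscale B (-1) (D (size b).-1 n))) < 1].
have cpos b : (0 < sumn b)%N -> 0 < c b by move=> ?; rewrite invr_gt0 mulr_gt0 // ltr0n.
have hK b x : (forall n, `|x n| <= q) -> (0 < sumn b)%N -> exists2 K, 0 < K &
    forall s, `|h b x s| <= K.
  move=> xq b0; have q0 : 0 <= q by exact: le_trans (normr_ge0 _) (xq 0%N).
  set T := c b * (q * l1_size (natseq R b)).
  have c0 := ltW (cpos b b0).
  have T0 : 0 <= T by apply: mulr_ge0 => //; apply: mulr_ge0 => //; exact: l1_size_ge0.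
  exists (`|f 0| + omega T + 1).
    by have := om0 T T0; have := normr_ge0 (f 0); lra.
  move=> s; have := (fP (c b *: comb x (natseq R b) s) 0).2; rewrite subr0 -/(h b x s) => h1.
  have h2 : `|c b *: comb x (natseq R b) s| <= T.
    rewrite normrZ ger0_norm // ler_wpM2l //; exact: comb_norm_le.
  have h3 := omM _ _ (normr_ge0 _) h2.
  have h4 : `|h b x s| <= `|f 0| + `|h b x s - f 0|.
    by rewrite -[X in `|X| <= _](subrK (f 0)) addrC; exact: ler_normD.
  lra.
exists Cl; split.
- move=> x xq xc; have [b [b0 sb]] := small_differences Uge nosm eta0 xq xc.
  have [K K0 hb] := hK b x xq b0.
  have mem : vmem (bidual (size b).-1.+1 W) (wlim (W := W) U (h b x) (size b).-1.+1 [::]).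
    by apply: (wlim_mem (W := W) (K := K) rW K0 _ _ _).1 => s; split=> //; exact: hb.
  have [n hn] := (DP _).2 _ mem 1 ltr01.
  by exists (b, n); split.
- by move=> [b n] x [].
move=> [b n] x x' phi.
suff one y y' psi : Cl (b, n) y -> Cl (b, n) y' -> functional psi ->
    ulim U (fun n => psi (y n)) - ulim U (fun n => psi (y' n)) <= delta.
  move=> C1 C2 fphi; rewrite ler_norml one // andbT.
  by have := one x' x phi C2 C1 fphi; lra.
case=> yq b0 sy ny [yq' _ sy' ny'] fpsi; rewrite leNgt; apply/negP => gap.
have [r sr] : exists r, size b = r.+1.
  by case: (b) b0 => [//|? b' _]; exists (size b').
rewrite /small sr in sy sy'; rewrite sr /= in ny ny'.
have [K1 K10 hK1] := hK b y yq b0; have [K2 K20 hK2] := hK b y' yq' b0.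
set K := Num.max K1 K2.
have K0 : 0 < K by rewrite lt_max K10.
have hKy s : `|h b y s| <= K by rewrite le_max hK1.
have hKy' s : `|h b y' s| <= K by rewrite le_max hK2 orbT.
have close x0 : iter_near V r.+1
      (fun p => `|comb (fun z => x0 z.1 - x0 z.2) (natseq R b) p| <= eta * (sumn b)%:R) ->
    iter_near V r.+1 (fun p => `|h b x0 (unzip1 p) - h b x0 (unzip2 p)| <= omega 1).
  apply: iter_near_mono => p _ hp; apply: le_trans (fP _ _).2 _; apply: omM => //.
  rewrite -scalerBr (comb_map fst) (comb_map snd) comb_sub normrZ gtr0_norm ?cpos //.
  by rewrite /c ler_pdivrMl ?mulr1 // mulr_gt0 // ltr0n.
have mem x0 : (forall s, `|h b x0 s| <= K) ->
    vmem (bidual r.+1 W) (wlim (W := W) U (h b x0) r.+1 [::]).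
  by move=> hx; apply: (wlim_mem (W := W) (K := K) rW K0 _ _ _).1 => s; split=> //; exact: hx.
apply: (kalton (U := U) K0 hKy hKy' (close y sy) (close y' sy') (e := 2)).
  move=> chi mchi nchi; set B := dual (bidual r W) in mchi nchi.
  have rB : regular B by apply: regular_dual; exact: regular_bidual.
  have near1 x0 : (forall s, `|h b x0 s| <= K) ->
      vnorm (dual B) (vadd (dual B) (wlim (W := W) U (h b x0) r.+1 [::])
        (vscale (dual B) (-1) (D r n))) < 1 ->
      `|wlim (W := W) U (h b x0) r.+1 [::] chi - D r n chi| < 1.
    move=> hx; apply: le_lt_trans.
    have := @le_dual_norm _ B rB (vadd (dual B) (wlim (W := W) U (h b x0) r.+1 [::])
        (vscale (dual B) (-1) (D r n))) chi.
    rewrite [X in `|X|]/= mulN1r; apply => //.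
    apply: (@dual_add_mem _ B); first exact: mem.
    by apply: (@dual_scale_mem _ B); exact: (DP r).1.
  have := near1 y hKy ny; have := near1 y' hKy' ny'.
  by rewrite !ltr_norml => /andP[? ?] /andP[? ?]; lra.
have bd (z : nat -> X) m : (forall n, `|z n| <= q) -> `|psi (z m)| <= q.
  by move=> zq; exact: le_trans (functional_norm fpsi _) (zq m).
have apart : U [set m | delta <= psi (y m - y' m)].
  have g0 : 0 < (ulim U (fun n => psi (y n)) - ulim U (fun n => psi (y' n)) - delta) / 2.
    by lra.
  have n1 := ulim_near (UV := UU) (fun m => bd y m yq) g0.
  have n2 := ulim_near (UV := UU) (fun m => bd y' m yq') g0.
  apply: filterS2 n1 n2 => m /=; rewrite !ltr_norml (functionalB fpsi).
  by move=> /andP[? ?] /andP[? ?]; lra.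
apply: (iter_near_mono _ (iter_near_each r.+1 apart)) => s ss sP.
apply: le_trans rhoR0 _; apply: le_trans _ (fP _ _).1; apply: rhoM; first exact: ltW.
rewrite -scalerBr comb_sub normrZ gtr0_norm ?cpos //.
have h1 : delta * (sumn b)%:R <= `|comb (fun m => y m - y' m) (natseq R b) s|.
  apply: le_trans _ (functional_le fpsi _); apply: functional_comb_ge; rewrite ?ss ?sr //.
have es0 : 0 < eta * (sumn b)%:R by rewrite mulr_gt0 // ltr0n.
rewrite /c ler_pdivlMl //; apply: le_trans h1.
by rewrite mulrAC /eta divfK ?gt_eqF.
Qed.

(** * Helly's lemma *)

Section Helly.
Context (R : realType) (X : normedModType R).
Let W := of_normed X.

Lemma functional_dual (phi : X -> R) : functional phi ->
  vmem (dual W) phi /\ vnorm (dual W) phi <= 1.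
Proof.
move=> fphi; split; last first.
  apply: dual_norm_le => // v _ v1; exact: le_trans (functional_norm fphi v) v1.
split=> [x y _ _|]; first exact: functionalD.
split=> [a x _|]; first exact: functionalZ.
by exists 1 => x _; rewrite mul1r; exact: functional_norm.
Qed.

Lemma dual_functional (phi : X -> R) :
  vmem (dual W) phi -> vnorm (dual W) phi <= 1 -> functional phi.
Proof.
move=> mphi n1; have [fD [fZ _]] := mphi; split=> [x y|a x|x].
- exact: fD.
- exact: fZ.
have rW := regular_of_normed X.
have [->|x0] := eqVneq x 0.
  by have := fZ 0 0 I; rewrite /= scale0r mul0r => ->; rewrite normr0.
have nx : 0 < `|x| by rewrite normr_gt0.
have := dual_eval_le rW mphi (v := x) I nx (lexx _) => h.
by apply: le_trans h _; rewrite ger_pMr.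
Qed.

Lemma dual_comb (G : car (dual (dual W))) (a : nat -> R) (f : nat -> X -> R) n :
  vmem (dual (dual W)) G -> (forall i, functional (f i)) ->
  exists g : car (dual W), [/\ vmem (dual W) g,
    forall x, g x = \sum_(0 <= i < n) a i * f i x &
    G g = \sum_(0 <= i < n) a i * G (f i)].
Proof.
move=> [GD [GZ _]] ff; elim: n => [|n [g [mg gE Gg]]].
  exists (vscale (dual W) 0 (f 0%N)).
  have [m0 _] := functional_dual (ff 0%N).
  split=> [|x|]; first exact: dual_scale_mem.
    by rewrite /= mul0r big_geq.
  by rewrite GZ // mul0r big_geq.
have [mf _] := functional_dual (ff n).
have mfa : vmem (dual W) (vscale (dual W) (a n) (f n)) by exact: dual_scale_mem.
exists (vadd (dual W) g (vscale (dual W) (a n) (f n))); split=> [|x|].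
- exact: dual_add_mem.
- by rewrite /= gE big_nat_recr.
- by rewrite GD // GZ // Gg big_nat_recr.
Qed.

(* Helly's lemma: a near minimizer [x] of the squared distance to the target
   values gives the functional [sum_i (G (f i) - f i x) f i] separating them. *)
Lemma helly (G : car (dual (dual W))) (q e : R) (f : nat -> X -> R) n :
  vmem (dual (dual W)) G -> 0 < q -> 0 < e ->
  (forall phi : X -> R, functional phi -> `|G phi| <= q) ->
  (forall i, functional (f i)) ->
  exists x, `|x| <= q /\ forall i, (i < n)%N -> `|f i x - G (f i)| < e.
Proof.
move=> mG q0 e0 Gq ff.
pose J x := \sum_(0 <= i < n) (f i x - G (f i)) ^+ 2.
pose S := [set r | exists2 x, `|x| <= q & r = J x].
have J0 x : 0 <= J x by apply: sumr_ge0 => i _; exact: sqr_ge0.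
have S0 : has_inf S.
  split; last by exists 0 => _ [x _ ->].
  by exists (J 0), 0; rewrite ?normr0 ?ltW.
set d := inf S.
have dJ x : `|x| <= q -> d <= J x by move=> xq; apply: ge_inf; [exact: S0.2|exists x].
have near_min eta : 0 < eta -> exists2 x, `|x| <= q & J x < d + eta.
  move=> eta0; have [|_ [x xq ->] h] := @inf_lt _ S (d + eta) S0.1; last by exists x.
  by rewrite ltrDl.
have [small|big] := ltP d (e ^+ 2).
  have [|x xq hx] := near_min (e ^+ 2 - d); first by rewrite subr_gt0.
  exists x; split=> // i ni.
  rewrite -ltr_sqr ?nnegrE ?normr_ge0 ?(ltW e0) // real_normK ?num_real //.
  have {}hx : J x < e ^+ 2 by move: hx; rewrite addrC subrK.
  apply: le_lt_trans hx; rewrite /J (big_rem i) /=; last by rewrite mem_index_iota.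
  by rewrite lerDl; apply: sumr_ge0 => j _; exact: sqr_ge0.
have d0 : 0 < d by apply: lt_le_trans big; rewrite exprn_gt0.
pose B := \sum_(0 <= i < n) (q + q) ^+ 2.
have B0 : 0 <= B by apply: sumr_ge0 => i _; exact: sqr_ge0.
(* This makes [t * B <= d / 2], so the quadratic term in the expansion of [J z] is at most t d / 2,
   the same as the slack allowed to the near minimizer. *)
pose t : R := d / (2 * (B + d)).
have Bd : 0 < B + d by lra.
have t0 : 0 < t by rewrite divr_gt0 // mulr_gt0.
have tBd : t * (B + d) = d / 2 by rewrite /t; field; rewrite ?gt_eqF.
have tB : t * B <= d / 2 by have := mulr_gt0 t0 d0; lra.
have t1 : t <= 1.
  by rewrite /t ler_pdivrMr ?mulr_gt0 // mul1r; lra.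
have t1' : 0 <= 1 - t by rewrite subr_ge0.
have [|x xq hx] := near_min (t * (d / 2)); first by rewrite mulr_gt0 //; lra.
pose a i := G (f i) - f i x.
have [g [mg gE Gg]] := dual_comb a n mG ff.
(* Moving from [x] towards [y] by the fraction [t] cannot bring [J] below [d]; expanding the square
   bounds the slope g y - g x, and G g - g x = J x >= d. *)
have gle y : `|y| <= q -> g y <= G g - d / 2.
  move=> yq; pose z := (1 - t) *: x + t *: y.
  have zq : `|z| <= q.
    have nx : `|(1 - t) *: x| <= (1 - t) * q by rewrite normrZ (ger0_norm t1') ler_wpM2l.
    have ny : `|t *: y| <= t * q by rewrite normrZ (gtr0_norm t0) ler_wpM2l // ltW.
    have := ler_normD ((1 - t) *: x) (t *: y); rewrite -/z; lra.
  have Jz : J z = J x - 2 * t * (g y - g x) + t ^+ 2 * \sum_(0 <= i < n) (f i y - f i x) ^+ 2.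
    rewrite !gE -sumrB !mulr_sumr -sumrB -big_split /=.
    apply: eq_bigr => i _; rewrite /z (functionalD (ff i)) !(functionalZ (ff i)) /a; ring.
  have sumB : \sum_(0 <= i < n) (f i y - f i x) ^+ 2 <= B.
    apply: ler_sum_nat => i _; rewrite -(real_normK (num_real _)).
    rewrite lerXn2r ?nnegrE ?addr_ge0 ?(ltW q0) //.
    apply: le_trans (ler_normB _ _) _; apply: lerD.
      exact: le_trans (functional_norm (ff i) y) yq.
    exact: le_trans (functional_norm (ff i) x) xq.
  have gapx : G g - g x = J x.
    rewrite Gg gE -sumrB; apply: eq_bigr => i _; rewrite /a; ring.
  have dx := dJ x xq; have dz := dJ z zq.
  have h1 : t ^+ 2 * \sum_(0 <= i < n) (f i y - f i x) ^+ 2 <= t * (d / 2).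
    rewrite expr2 -mulrA ler_pM2l //; apply: le_trans _ tB.
    by rewrite ler_pM2l.
  have h2 : t * (2 * (g y - g x)) < t * d by rewrite Jz in dz; lra.
  by rewrite ltr_pM2l // in h2; lra.
have s0 : 0 <= G g - d / 2.
  have := gle 0; rewrite normr0 => /(_ (ltW q0)); apply: le_trans.
  by rewrite gE big1 // => i _; rewrite (functional0 (ff i)) mulr0.
(* A positive level strictly between the bound of [g] on the [q]-ball and [G g]: scaling [g] by q /
   s gives a functional on which [G] exceeds [q]. *)
set s := G g - d / 4.
have sp : 0 < s by rewrite /s; lra.
have [gD [gZ _]] := mg.
pose phi y := (q / s) * g y.
have fphi : functional phi.
  have qs : 0 < q / s by rewrite divr_gt0.
  have le1 y : phi y <= `|y|.
    rewrite /phi; have [->|y0] := eqVneq y 0.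
      by rewrite normr0 gE big1 ?mulr0 // => i _; rewrite (functional0 (ff i)) mulr0.
    have ny : 0 < `|y| by rewrite normr_gt0.
    have := gle ((q / `|y|) *: y).
    rewrite normrZ gtr0_norm ?divr_gt0 // divfK ?gt_eqF // => /(_ (lexx _)).
    rewrite (gZ (q / `|y|) y I) => h.
    have h2 : q / `|y| * g y <= s by rewrite /s; lra.
    have -> : q / s * g y = (q / `|y| * g y) * (`|y| / s) by field; rewrite ?gt_eqF.
    have ys0 : 0 <= `|y| / s by rewrite divr_ge0 // ltW.
    by apply: le_trans (ler_wpM2r ys0 h2) _; rewrite mulrCA mulfV ?mulr1 ?gt_eqF.
  split=> [y z|c y|y].
  - by rewrite /phi (gD y z I I) mulrDr.
  - by rewrite /phi (gZ c y I) mulrCA.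
  - rewrite ler_norml le1 andbT; have := le1 (- y); rewrite normrN /phi -scaleN1r (gZ (-1) y I).
    by rewrite mulN1r mulrN; lra.
have := Gq phi fphi; have -> : G phi = q / s * G g.
  by have [_ [GZ _]] := mG; have := GZ (q / s) g mg.
move=> hG; have h := le_trans (ler_norm _) hG.
have : G g <= s.
  rewrite -(ler_pM2l (divr_gt0 q0 sp)); apply: le_trans h _.
  by rewrite divfK ?gt_eqF.
by rewrite /s; lra.
Qed.

End Helly.

(** * A countable dense subset of the bidual *)

Theorem theorem5p8 (R : realType) (X Y : completeNormedModType R) :
  separable (of_normed X) ->
  ~ separable (idual 2 (of_normed X)) ->
  ~ l1_embeds X ->
  (forall (x : nat -> X) (sm : seq R -> R),
      (forall n, `|x n| = 1) -> weakly_null x -> generates_sm x sm ->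
      ~ sm_equiv_l1 sm) ->
  (exists f : X -> Y, coarse_embedding f) ->
  exists k : nat, (0 < k)%N /\ ~ separable (idual (2 * k) (of_normed Y)).
Proof.
move=> _ nsep nl1 nosm [f cf]; apply: contrapT => none; apply: nsep.
have sepY k : (0 < k)%N -> separable (bidual k (of_normed Y)).
  move=> k0; rewrite -idual_double; apply: contrapT => ns.
  by apply: none; exists k.
have [U [UU Uge]] := free_ultrafilter.
set W := of_normed X; have rW : regular W by exact: regular_of_normed.
have dpos (p : nat) : 0 < p.+1%:R^-1 :> R by rewrite invr_gt0 ltr0n.
have hCl (pq : nat * nat) :=
  coarse_classes (UU := UU) pq.2.+1%:R Uge nosm cf sepY (dpos pq.1).
have [Cl ClP] := choice hCl.
pose I := (nat * nat * (seq nat * nat))%type.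
(* [i] codes a precision 1/(p+1), a norm bound Q+1 and a class. [D i] is the weak-star limit of a
   member of that class, and 0 if the class is empty or [i] codes nothing. *)
have /choice[D DP] (i : nat) : exists d : car (idual 2 W), vmem (idual 2 W) d /\
    forall p Q c, (unpickle i : option I) = Some (p, Q, c) -> forall x, Cl (p, Q) c x ->
      forall phi : X -> R, functional phi ->
        `|ulim U (fun n => phi (x n)) - d phi| <= p.+1%:R^-1.
  have zero : vmem (idual 2 W) (fun _ => 0).
    split=> [f1 f2 _ _|]; first by rewrite addr0.
    split=> [r f1 _|]; first by rewrite mulr0.
    by exists 0 => f1 _; rewrite normr0 mul0r.
  case E : (unpickle i : option I) => [[[p Q] c]|]; last by exists (fun _ => 0).
  have [[x0 Cx0]|nC] := pselect (exists x0, Cl (p, Q) c x0); last first.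
    exists (fun _ => 0); split=> // p' Q' c' [<- <- <-] x Cx.
    by case: nC; exists x.
  have [_ C2 C3] := ClP (p, Q).
  exists (wlim (W := W) U (fun s => x0 (head 0%N s)) 1 [::]); split.
    have Q0 : 0 < Q.+1%:R :> R by rewrite ltr0n.
    apply: (wlim_mem (W := W) rW Q0 _ 1 [::]).1 => s; split=> //; exact: C2 Cx0 _.
  move=> p' Q' c' [<- <- <-] x Cx phi fphi; exact: C3 Cx Cx0 fphi.
exists D; split=> [n|G mG e e0]; first exact: (DP n).1.
apply: contrapT => far.
have /choice[g gP] (n : nat) : exists phi : X -> R, functional phi /\
    e / 2 < `|G phi - D n phi|.
  apply: contrapT => h; apply: far; exists n.
  apply: (@le_lt_trans _ _ (e / 2)); last lra.
  apply: (@dual_norm_le _ (dual W)); first lra.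
  move=> phi mphi nphi; rewrite leNgt; apply/negP => hphi; apply: h; exists phi.
  split; first exact: dual_functional.
  by move: hphi; rewrite /= mulN1r.
have Gle (phi : X -> R) : functional phi -> `|G phi| <= vnorm (dual (dual W)) G.
  move=> /functional_dual[mphi nphi].
  exact: (@le_dual_norm _ (dual W) (regular_dual rW) G phi mG mphi nphi).
have G0 : 0 <= vnorm (dual (dual W)) G.
  exact: (@dual_norm_ge0 _ (dual W) (regular_dual rW) G mG).
pose Q := Num.bound (vnorm (dual (dual W)) G).
have Q0 : 0 < Q.+1%:R :> R by rewrite ltr0n.
have GQ (phi : X -> R) : functional phi -> `|G phi| <= Q.+1%:R.
  move=> fphi; apply: le_trans (Gle phi fphi) _; apply: ltW.
  by apply: lt_trans (archi_boundP G0) _; rewrite ltr_nat.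
(* The [k]-th point agrees with [G] on the functionals g_0, ..., g_k up to 1/(k+1). *)
have hx (k : nat) := helly k.+1 mG Q0 (dpos k) GQ (fun i => (gP i).1).
have [x xP] := choice hx.
have [m [mge mc]] := rosenthal_l1 nl1 (fun k => (xP k).1).
have e8 : 0 < e / 8 by lra.
have [p hp] := exists_invS_lt e8.
have [C1 _ _] := ClP (p, Q).
have [c Cc] := C1 (fun l => x (m l)) (fun l => (xP (m l)).1) mc.
pose i := pickle ((p, Q, c) : I).
have h1 := (DP i).2 p Q c (pickleK _) _ Cc (g i) (gP i).1.
have bd l : `|g i (x (m l))| <= Q.+1%:R.
  exact: le_trans (functional_norm (gP i).1 _) (xP (m l)).1.
have : U ([set l | (maxn i p <= l)%N] `&`
    [set l | `|ulim U (fun l => g i (x (m l))) - g i (x (m l))| < e / 8]).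
  by apply: filterI; [exact: Uge|exact: ulim_near bd e8].
move=> /filter_ex[l [/= lmax h2]]; move: lmax; rewrite geq_max => /andP[il pl].
have h3 := (xP (m l)).2 i (leq_trans il (mge l)).
have h4 : (m l).+1%:R^-1 < e / 8.
  apply: le_lt_trans hp; rewrite lef_pV2 ?posrE ?ltr0n // ler_nat ltnS.
  exact: leq_trans pl (mge l).
have := (gP i).2; set A := ulim U _ in h1 h2.
have -> : G (g i) - D i (g i) = (A - D i (g i)) - ((A - g i (x (m l))) + (g i (x (m l)) - G (g i))).
  by ring.
have := ler_normB (A - D i (g i)) ((A - g i (x (m l))) + (g i (x (m l)) - G (g i))).
have := ler_normD (A - g i (x (m l))) (g i (x (m l)) - G (g i)).
have h5 := lt_trans h3 h4;
move=> k1 k2 k3; have h7 := le_lt_trans h1 hp; lra.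
Qed.
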